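(* Let $(\Omega,\leq)$ be a totally ordered set on which $\mathrm{Aut}(\Omega,\leq)$ acts transitively, and suppose that the groups $\mathrm{Aut}(\Omega,\leq)$ and $\mathrm{Aut}(\mathbb{R},\leq)$ satisfy the same first-order sentences in the language of groups. Then $\Omega$ is isomorphic to $\mathbb{R}$ as an ordered set.
   Context: For a totally ordered set $(\Omega,\leq)$, $\mathrm{Aut}(\Omega,\leq)$ denotes the group (under composition) of all order-preserving bijections $\Omega\to\Omega$. It acts transitively on $\Omega$ if for all $\alpha,\beta\in\Omega$ there is $g\in \mathrm{Aut}(\Omega,\leq)$ mapping $\alpha$ to $\beta$. $\mathbb{R}$ carries its usual order. *)

(* Defs.v *)
From HB Require Import structures.
From mathcomp Require Import all_boot all_order all_algebra.
From mathcomp Require Import boolp reals.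

Set Implicit Arguments.
Unset Strict Implicit.
Unset Printing Implicit Defensive.

Import Order.TTheory.

(** * First-order logic in the language (1, *, ^-1) of groups *)

Inductive gterm : Type :=
| GVar of nat
| GOne
| GMul of gterm & gterm
| GInv of gterm.

Inductive gformula : Type :=
| GEq of gterm & gterm
| GFalse
| GNot of gformula
| GAnd of gformula & gformula
| GOr of gformula & gformula
| GImp of gformula & gformula
| GForall of nat & gformula
| GExists of nat & gformula.

Fixpoint gterm_vars (t : gterm) : seq nat :=
  match t with
  | GVar i => [:: i]
  | GOne => [::]
  | GMul t1 t2 => gterm_vars t1 ++ gterm_vars t2
  | GInv t1 => gterm_vars t1
  end.

Fixpoint free_vars (phi : gformula) : seq nat :=
  match phi with
  | GEq t1 t2 => gterm_vars t1 ++ gterm_vars t2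
  | GFalse => [::]
  | GNot p => free_vars p
  | GAnd p q | GOr p q | GImp p q => free_vars p ++ free_vars q
  | GForall i p | GExists i p => [seq j <- free_vars p | j != i]
  end.

Definition sentence (phi : gformula) : Prop := free_vars phi = [::].

Section Semantics.
Variable G : groupType.
Implicit Type v : nat -> G.

Definition update v (i : nat) (a : G) : nat -> G :=
  fun j => if j == i then a else v j.

Fixpoint gterm_eval v (t : gterm) : G :=
  match t with
  | GVar i => v i
  | GOne => 1%g
  | GMul t1 t2 => (gterm_eval v t1 * gterm_eval v t2)%g
  | GInv t1 => (gterm_eval v t1)^-1%g
  end.

Fixpoint sat v (phi : gformula) : Prop :=
  match phi with
  | GEq t1 t2 => gterm_eval v t1 = gterm_eval v t2
  | GFalse => False
  | GNot p => ~ sat v p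
  | GAnd p q => sat v p /\ sat v q
  | GOr p q => sat v p \/ sat v q
  | GImp p q => sat v p -> sat v q
  | GForall i p => forall a : G, sat (update v i a) p
  | GExists i p => exists a : G, sat (update v i a) p
  end.

(* The valuation is immaterial when phi is a sentence. *)
Definition models (phi : gformula) : Prop := sat (fun=> 1%g) phi.

End Semantics.

Definition elementarily_equivalent (G H : groupType) : Prop :=
  forall phi : gformula, sentence phi -> (models G phi <-> models H phi).

(** * The automorphism group of a totally ordered set *)

Section Aut.
Variables (d : Order.disp_t) (T : orderType d).
Local Open Scope order_scope.

Record order_aut : Type := OrderAut {
  aut_fun :> T -> T;
  aut_bij : bijective aut_fun;
  aut_homo : {homo aut_fun : x y / x <= y}
}.

Lemma order_aut_eq (f g : order_aut) : f =1 g -> f = g.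
Proof.
case: f g => [f bf hf] [g bg hg] /= /funext fg; subst g.
by rewrite (Prop_irrelevance bf bg) (Prop_irrelevance hf hg).
Qed.

Definition aut_one : order_aut :=
  @OrderAut id (Bijective (fun=> erefl) (fun=> erefl)) (fun _ _ xy => xy).

Definition aut_mul (f g : order_aut) : order_aut :=
  @OrderAut (f \o g) (bij_comp (aut_bij f) (aut_bij g))
    (fun _ _ xy => aut_homo f (aut_homo g xy)).

Lemma aut_has_inv (f : order_aut) : exists g : T -> T, cancel f g /\ cancel g f.
Proof. by case: (aut_bij f) => g fK gK; exists g. Qed.

Definition aut_inv_fun (f : order_aut) : T -> T := projT1 (cid (aut_has_inv f)).

Lemma aut_funK (f : order_aut) : cancel f (aut_inv_fun f).
Proof. exact: (projT2 (cid (aut_has_inv f))).1. Qed.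

Lemma aut_inv_funK (f : order_aut) : cancel (aut_inv_fun f) f.
Proof. exact: (projT2 (cid (aut_has_inv f))).2. Qed.

Lemma aut_inv_bij (f : order_aut) : bijective (aut_inv_fun f).
Proof. exact: Bijective (aut_inv_funK f) (aut_funK f). Qed.

Lemma aut_inv_homo (f : order_aut) : {homo aut_inv_fun f : x y / x <= y}.
Proof.
move=> x y xy; case: leP => // lt_fyx.
have := aut_homo f (ltW lt_fyx); rewrite !aut_inv_funK => yx.
have exy : x = y by apply/le_anti; rewrite xy yx.
by move: lt_fyx; rewrite exy ltxx.
Qed.

Definition aut_inv (f : order_aut) : order_aut :=
  OrderAut (aut_inv_bij f) (@aut_inv_homo f).

HB.instance Definition _ := gen_eqMixin order_aut.
HB.instance Definition _ := gen_choiceMixin order_aut.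

Lemma aut_mulA : associative aut_mul.
Proof. by move=> f g h; apply: order_aut_eq. Qed.

Lemma aut_mul1 : left_id aut_one aut_mul.
Proof. by move=> f; apply: order_aut_eq. Qed.

Lemma aut_mulr1 : right_id aut_one aut_mul.
Proof. by move=> f; apply: order_aut_eq. Qed.

Lemma aut_mulV : left_inverse aut_one aut_inv aut_mul.
Proof. by move=> f; apply: order_aut_eq => x /=; rewrite aut_funK. Qed.

Lemma aut_mulrV : right_inverse aut_one aut_inv aut_mul.
Proof. by move=> f; apply: order_aut_eq => x /=; rewrite aut_inv_funK. Qed.

HB.instance Definition _ :=
  isGroup.Build order_aut aut_mulA aut_mul1 aut_mulr1 aut_mulV aut_mulrV.

Definition aut_transitive : Prop :=
  forall a b : T, exists g : order_aut, g a = b.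

End Aut.

Definition order_isomorphic (d d' : Order.disp_t) (T : orderType d)
    (T' : orderType d') : Prop :=
  exists f : T -> T', bijective f /\ {mono f : x y / (x <= y)%O}.

(* Main.v *)
Require Import Defs.
From mathcomp Require Import all_boot all_order all_algebra.
From mathcomp Require Import boolp reals.
From mathcomp Require Import zify ring lra.

(* One sentence, true in Aut(R), recovers the line. Its first two clauses (an
   element conjugate to its inverse; every noncommuting f, g admit a Klein bottle
   group commuting with its conjugates by f and by g) force, in the automorphism
   group of any transitive order, nontrivial automorphisms supported in
   arbitrarily small intervals. Then Rubin's formula [disj] expresses that two
   automorphisms have disjoint supports, so that supports, bumps (one orbital)
   and half-lines (the orbital of a bump f with supp f properly contained in
   g (supp f), for a fixed-point free g) can be discussed in the language of groups.
   - Separability: for some h, w the orbitals of w are permuted transitively by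
     the powers of h, and no u <> 1 commuting with g preserves all of them. As
     a product of translates by powers of g of an automorphism supported in a
     small interval commutes with g, the countably many cuts g^m h^n e, where e
     ends an orbital of w, are dense.
   - Completeness: the group acts 2-homogeneously on the endpoints of half-lines,
     and these are dense. Gluing automorphisms along a Z-chain of them, every cut
     of countable cofinality ends the orbital of a bump, hence is conjugate to
     a cut {z | z < a}, which has a supremum.
   Cantor's back-and-forth then gives an isomorphism with R. *)

Set Implicit Arguments.
Unset Strict Implicit.
Unset Printing Implicit Defensive.

Import Order.TTheory GRing.Theory Num.Theory.

(** * The sentence *)

(** The group sees no points, and the order at most up to reversal. [disj] means disjointness of
    supports only once small supports are known to exist, so the clauses that produce them are bare
    equations between words. The relation [b * a = a^-1 * b] serves because order automorphisms have
    no 2-torsion: at a point moved by [a] it forbids commutation even locally, and [b] carries each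
    point moved by [a] out of its [a]-orbital. The rationals show what completeness must exclude:
    there half-lines end at rational and at irrational cuts, and no automorphism exchanges the two
    kinds, so [homogeneous] fails. Gaps need not be recognized one by one: it is enough that all
    half-line ends are conjugate and that some of them are points. *)

Section GroupFormulas.
Variable G : groupType.
Implicit Types a b c f g h p r u w : G.
Local Open Scope group_scope.

Definition conjl f h := f * h * f^-1.
Definition commut f h := f * h * f^-1 * h^-1.

Definition disj f g := forall h, f * h <> h * f -> exists f1 f2,
  f1 * g = g * f1 /\ f2 * g = g * f2 /\ commut f1 (commut f2 h) <> 1 /\
  commut f1 (commut f2 h) * g = g * commut f1 (commut f2 h).

Definition is_bump f := f <> 1 /\
  forall p r, f = p * r -> disj p r -> p = 1 \/ r = 1.

(** For arbitrary elements this compares supports only up to nowhere dense sets: a support with one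
    interior point removed gives the same relation. Between bumps, whose supports are convex and
    have no extremal points, it is true inclusion ([supp_leP]). *)
Definition supp_le f g := forall h, disj h g -> disj h f.

Definition half_line g f := is_bump f /\ supp_le f (conjl g f) /\ ~ supp_le (conjl g f) f.

Definition full_bump g := is_bump g /\ forall h, disj h g -> h = 1.

Definition commutes_with_conj a b f :=
  a * conjl f a = conjl f a * a /\ a * conjl f b = conjl f b * a /\
  b * conjl f a = conjl f a * b /\ b * conjl f b = conjl f b * b.

Definition has_inverted := exists c f, f <> 1 /\ c * f = f^-1 * c.

Definition locally_moving := forall f g, f * g <> g * f ->
  exists a b, a <> 1 /\ b * a = a^-1 * b /\ commutes_with_conj a b f /\
    commutes_with_conj a b g.

Definition separated g := exists h w, h * w = w * h /\
  (forall p r, w = p * r -> disj p r -> p * h = h * p -> r * h = h * r ->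
    p = 1 \/ r = 1) /\
  forall u, u * g = g * u ->
    (forall p r, w = p * r -> disj p r -> disj (conjl u p) r) -> u = 1.

Definition faithful g := forall h, h <> 1 ->
  exists f, half_line g f /\ ~ (supp_le f (conjl h f) /\ supp_le (conjl h f) f).

Definition homogeneous g :=
  forall f1 f2, half_line g f1 -> half_line g f2 -> supp_le f1 f2 -> ~ supp_le f2 f1 ->
  forall k1 k2, half_line g k1 -> half_line g k2 -> supp_le k1 k2 -> ~ supp_le k2 k1 ->
  exists c, supp_le (conjl c f1) k1 /\ supp_le k1 (conjl c f1) /\
    supp_le (conjl c f2) k2 /\ supp_le k2 (conjl c f2).

(** The last clauses are asked of [g] and of [g^-1] because a full bump may move points up or down
    and the group cannot tell which. [separated] depends on [g] only through its centralizer, which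
    [g^-1] shares. *)
Definition line_like := has_inverted /\ locally_moving /\
  exists g, full_bump g /\ separated g /\ faithful g /\ homogeneous g /\
    faithful g^-1 /\ homogeneous g^-1.

End GroupFormulas.

(* In these formulas [k] is the first variable available for binding. *)
Definition tconj s t := GMul (GMul s t) (GInv s).
Definition tcomm s t := GMul (GMul (GMul s t) (GInv s)) (GInv t).
Definition fcommute s t := GEq (GMul s t) (GMul t s).
Definition fdisj k s t :=
  let h := GVar k in let f1 := GVar k.+1 in let f2 := GVar k.+2 in
  GForall k (GImp (GNot (fcommute s h)) (GExists k.+1 (GExists k.+2
    (GAnd (fcommute f1 t) (GAnd (fcommute f2 t)
      (GAnd (GNot (GEq (tcomm f1 (tcomm f2 h)) GOne))
            (fcommute (tcomm f1 (tcomm f2 h)) t))))))).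
Definition fsplit k s phi :=
  let p := GVar k in let r := GVar k.+1 in
  GForall k (GForall k.+1 (GImp (GEq s (GMul p r)) (GImp (fdisj k.+2 p r) phi))).
Definition ftriv k := GOr (GEq (GVar k) GOne) (GEq (GVar k.+1) GOne).
Definition fbump k s := GAnd (GNot (GEq s GOne)) (fsplit k s (ftriv k)).
Definition fbelow k s t :=
  GForall k (GImp (fdisj k.+1 (GVar k) t) (fdisj k.+1 (GVar k) s)).
Definition fhalf k t s := GAnd (fbump k s)
  (GAnd (fbelow k s (tconj t s)) (GNot (fbelow k (tconj t s) s))).
Definition ffull k t := GAnd (fbump k t)
  (GForall k (GImp (fdisj k.+1 (GVar k) t) (GEq (GVar k) GOne))).
Definition fcommutes_with_conj a b s :=
  GAnd (fcommute a (tconj s a)) (GAnd (fcommute a (tconj s b))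
    (GAnd (fcommute b (tconj s a)) (fcommute b (tconj s b)))).
Definition finverted :=
  GExists 0 (GExists 1 (GAnd (GNot (GEq (GVar 1) GOne))
    (GEq (GMul (GVar 0) (GVar 1)) (GMul (GInv (GVar 1)) (GVar 0))))).
Definition flocally_moving :=
  let f := GVar 0 in let g := GVar 1 in let a := GVar 2 in let b := GVar 3 in
  GForall 0 (GForall 1 (GImp (GNot (fcommute f g)) (GExists 2 (GExists 3
    (GAnd (GNot (GEq a GOne)) (GAnd (GEq (GMul b a) (GMul (GInv a) b))
       (GAnd (fcommutes_with_conj a b f) (fcommutes_with_conj a b g)))))))).
Definition fseparated k t :=
  let h := GVar k in let w := GVar k.+1 in let u := GVar k.+2 in
  GExists k (GExists k.+1 (GAnd (fcommute h w) (GAnd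
    (fsplit k.+2 w (GImp (fcommute (GVar k.+2) h)
       (GImp (fcommute (GVar k.+3) h) (ftriv k.+2))))
    (GForall k.+2 (GImp (fcommute u t)
      (GImp (fsplit k.+3 w
               (fdisj k.+4.+1 (tconj u (GVar k.+3)) (GVar k.+4)))
         (GEq u GOne))))))).
Definition ffaithful k t :=
  let h := GVar k in let f := GVar k.+1 in
  GForall k (GImp (GNot (GEq h GOne)) (GExists k.+1
    (GAnd (fhalf k.+2 t f) (GNot (GAnd
       (fbelow k.+2 f (tconj h f)) (fbelow k.+2 (tconj h f) f)))))).
Definition fpair k i t phi :=
  GImp (fhalf k t (GVar i)) (GImp (fhalf k t (GVar i.+1))
    (GImp (fbelow k (GVar i) (GVar i.+1))
      (GImp (GNot (fbelow k (GVar i.+1) (GVar i))) phi))).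
Definition fhomogeneous k t :=
  let f1 := GVar k in let f2 := GVar k.+1 in
  let k1 := GVar k.+2 in let k2 := GVar k.+3 in let c := GVar k.+4 in
  let m := k.+4.+1 in
  GForall k (GForall k.+1 (fpair m k t
  (GForall k.+2 (GForall k.+3 (fpair m k.+2 t
  (GExists k.+4
    (GAnd (fbelow m (tconj c f1) k1) (GAnd (fbelow m k1 (tconj c f1))
    (GAnd (fbelow m (tconj c f2) k2) (fbelow m k2 (tconj c f2))))))))))).
Definition fline_like := let g := GVar 0 in
  GAnd finverted (GAnd flocally_moving (GExists 0
    (GAnd (ffull 1 g) (GAnd (fseparated 1 g)
       (GAnd (ffaithful 1 g) (GAnd (fhomogeneous 1 g)
          (GAnd (ffaithful 1 (GInv g)) (fhomogeneous 1 (GInv g))))))))).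

Lemma fline_like_sentence : sentence fline_like.
Proof. by vm_compute. Qed.

(** Holds by computation: all variable indices are closed numerals, so every [update] reduces, and
    the group-theoretic definitions mirror the formulas connective by connective. *)
Lemma models_fline_like (G : groupType) : models G fline_like = line_like G.
Proof. reflexivity. Qed.

Lemma line_like_equiv (G H : groupType) :
  elementarily_equivalent G H -> line_like H -> line_like G.
Proof.
move=> eqGH; have := eqGH _ fline_like_sentence.
by rewrite !models_fline_like => -[].
Qed.

(** * Automorphisms, orbitals and restrictions *)

Section IntegerPowers.
Variable G : groupType.
Implicit Types f g : G.
Local Open Scope group_scope.

Definition zexpg f (n : int) : G :=
  match n with Posz m => f ^+ m | Negz m => f ^- m.+1 end.

Lemma zexpg0 f : zexpg f 0%R = 1. Proof. by []. Qed.

Lemma zexpgS f n : zexpg f (n + 1)%R = f * zexpg f n.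
Proof.
case: n => [m|[|m]]; first by rewrite -PoszD addn1 /= expgS.
  by rewrite NegzE addNr /= expg1 mulgV.
have -> : (Negz m.+1 + 1 = Negz m)%R by rewrite !NegzE; lia.
by rewrite /= (expgSr f m.+1) invgM mulVKg.
Qed.

Lemma zexpgP f n : zexpg f (n - 1)%R = f^-1 * zexpg f n.
Proof. by rewrite -{2}(subrK 1%R n) zexpgS mulKg. Qed.

Lemma int_step_ind (P : int -> Prop) : P 0%R ->
  (forall n, P n -> P (n + 1)%R) -> (forall n, P n -> P (n - 1)%R) ->
  forall n, P n.
Proof.
move=> P0 PS PP; elim/int_rect => // n IH; first by rewrite -addn1 PoszD; apply: PS.
by rewrite -addn1 PoszD opprD; apply: PP.
Qed.

Lemma zexpgD f m n : zexpg f (m + n)%R = zexpg f m * zexpg f n.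
Proof.
elim/int_step_ind: m => [|m IH|m IH]; first by rewrite add0r zexpg0 mul1g.
  by rewrite addrAC !zexpgS IH mulgA.
by rewrite addrAC !zexpgP IH mulgA.
Qed.

Lemma zexpg1 f : zexpg f 1%R = f. Proof. exact: expg1. Qed.

Lemma zexpgN f n : zexpg f (- n)%R = (zexpg f n)^-1.
Proof. by apply: (mulIg (zexpg f n)); rewrite -zexpgD addNr mulVg. Qed.

Lemma zexpgSr f n : zexpg f (n + 1)%R = zexpg f n * f.
Proof. by rewrite zexpgD zexpg1. Qed.

Lemma zexpg_commute f g n : f * g = g * f -> f * zexpg g n = zexpg g n * f.
Proof.
move=> fg; case: n => m /=; first exact: commuteX.
by apply: commuteV; apply: commuteX.
Qed.

Lemma zexpgV f n : zexpg f^-1 n = zexpg f (- n)%R.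
Proof.
elim/int_step_ind: n => // n IH; first by rewrite opprD zexpgS zexpgP IH.
by rewrite zexpgP IH invgK opprB [(1 - n)%R]addrC zexpgS.
Qed.

Lemma zexpg_conj f g n : zexpg (conjl g f) n = conjl g (zexpg f n).
Proof.
elim/int_step_ind: n => [|n IH|n IH]; first by rewrite /conjl !zexpg0 mulg1 mulgV.
  by rewrite !zexpgS IH /conjl !mulgA mulgVK.
by rewrite !zexpgP IH /conjl !invgM invgK !mulgA mulgVK.
Qed.

End IntegerPowers.

Lemma int_first_failure (P : int -> Prop) m n :
  P m -> ~ P n -> (m <= n)%R ->
  exists k : int, [/\ (m <= k)%R, (k < n)%R, P k & ~ P (k + 1)%R].
Proof.
move=> Pm Pn lemn; have [k nE] : exists k : nat, n = (m + k%:Z)%R.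
  by exists `|n - m|%N; lia.
subst n; elim: k Pn {lemn} => [|k IH]; first by rewrite addr0.
rewrite -addn1 PoszD addrA => Pn; have [Pk|/IH [j [? ? ? ?]]] := pselect (P (m + k%:Z)%R).
  by exists (m + k%:Z)%R; split=> //; lia.
by exists j; split=> //; lia.
Qed.

Section Basics.
Variables (d : Order.disp_t) (T : orderType d).
Local Notation G := (order_aut T).
Implicit Types (f g h r : G) (x y z : T) (H : G -> Prop).
Local Open Scope order_scope.

Lemma autM f g x : (f * g)%g x = f (g x). Proof. by []. Qed.
Lemma aut1 x : (1%g : G) x = x. Proof. by []. Qed.
Lemma autK f : cancel f (f^-1)%g. Proof. exact: aut_funK. Qed.
Lemma autVK f : cancel (f^-1)%g f. Proof. exact: aut_inv_funK. Qed.
Lemma aut_inj f : injective f. Proof. exact: can_inj (autK f). Qed.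

Lemma aut_le f : {mono f : x y / x <= y}.
Proof.
move=> x y; apply/idP/idP => [|/aut_homo //].
by move/(aut_homo (f^-1)%g); rewrite !autK.
Qed.

Lemma aut_lt f : {mono f : x y / x < y}.
Proof. exact: leW_mono (aut_le f). Qed.

Lemma aut_leV f x y : ((f^-1)%g x <= y) = (x <= f y).
Proof. by rewrite -(aut_le f) autVK. Qed.
Lemma aut_ltV f x y : ((f^-1)%g x < y) = (x < f y).
Proof. by rewrite -(aut_lt f) autVK. Qed.
Lemma aut_leVr f x y : (y <= (f^-1)%g x) = (f y <= x).
Proof. by rewrite -(aut_le f) autVK. Qed.
Lemma aut_ltVr f x y : (y < (f^-1)%g x) = (f y < x).
Proof. by rewrite -(aut_lt f) autVK. Qed.

Lemma aut_moves f : f <> 1%g -> exists x, f x <> x.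
Proof. by move=> f1; apply/existsNP => fE; apply: f1; apply: order_aut_eq. Qed.

Lemma aut_neq1 f x : f x <> x -> f <> 1%g.
Proof. by move=> fx f1; apply: fx; rewrite f1. Qed.

Lemma autV_fix f x : f x = x -> (f^-1)%g x = x.
Proof. by move=> fx; rewrite -{1}fx autK. Qed.

Lemma autV_fixE f x : (f^-1)%g x = x <-> f x = x.
Proof. by split=> [e|/autV_fix//]; rewrite -{1}e autVK. Qed.

Lemma build_aut (F F' : T -> T) : cancel F F' -> cancel F' F ->
  {homo F : x y / x <= y} -> exists f : G, f =1 F.
Proof. by move=> FK F'K Fh; exists (OrderAut (Bijective FK F'K) Fh). Qed.

Lemma conjlE f g x : conjl g f (g x) = g (f x).
Proof. by rewrite /conjl !autM autK. Qed.

Lemma conjl_fix f g x : conjl g f x = x <-> f ((g^-1)%g x) = (g^-1)%g x.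
Proof.
rewrite /conjl !autM; split=> [e|->]; last by rewrite autVK.
by rewrite -{2}e autK.
Qed.

Definition subg H :=
  [/\ H 1%g, forall f g, H f -> H g -> H (f * g)%g & forall f, H f -> H (f^-1)%g].

(** For a subgroup [H] this is an equivalence relation whose classes are the convex hulls of the
    [H]-orbits. For a cyclic group the classes of moved points are the orbitals of the generator. *)
Definition orb H x y := exists h k, [/\ H h, H k, h x <= y & y <= k x].

Section Orb.
Variable H : G -> Prop.
Hypothesis sgH : subg H.

Lemma orb_refl x : orb H x x.
Proof. by case: sgH => H1 _ _; exists 1%g, 1%g; rewrite aut1. Qed.

Lemma orb_sym x y : orb H x y -> orb H y x.
Proof.
case: sgH => _ _ HV [h [k [Hh Hk hx kx]]]; exists (k^-1)%g, (h^-1)%g.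
by split; [exact: HV|exact: HV|rewrite aut_leV|rewrite aut_leVr].
Qed.

Lemma orb_trans x y z : orb H x y -> orb H y z -> orb H x z.
Proof.
case: sgH => _ HM _ [h [k [Hh Hk hx kx]]] [h' [k' [Hh' Hk' hy ky]]].
exists (h' * h)%g, (k' * k)%g; split; [exact: HM|exact: HM| |].
  by apply: le_trans hy; rewrite autM aut_le.
by apply: (le_trans ky); rewrite autM aut_le.
Qed.

Lemma orb_convex x y z t : orb H x y -> orb H x z -> y <= t -> t <= z -> orb H x t.
Proof.
move=> [h [_ [Hh _ hx _]]] [_ [k [_ Hk _ kx]]] yt tz.
by exists h, k; split=> //; [exact: le_trans yt|exact: le_trans kx].
Qed.

Lemma orb_act x h : H h -> orb H x (h x).
Proof. by move=> Hh; exists h, h. Qed.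

Lemma orb_actE x y h : H h -> orb H x (h y) <-> orb H x y.
Proof.
move=> Hh; split=> /orb_trans; apply; last exact: orb_act.
by apply: orb_sym; apply: orb_act.
Qed.

Lemma orb_unbounded x y : orb H x y -> exists2 h, H h & y <= h x.
Proof. by move=> [_ [k [_ Hk _ kx]]]; exists k. Qed.

Lemma orb_unboundedl x y : orb H x y -> exists2 h, H h & h x <= y.
Proof. by move=> [k [_ [Hk _ kx _]]]; exists k. Qed.

End Orb.

Lemma orb_image H K c x y : (forall h, H h -> K (conjl c h)) ->
  orb H x y -> orb K (c x) (c y).
Proof.
move=> HK [h [k [Hh Hk hx kx]]]; exists (conjl c h), (conjl c k).
by rewrite !conjlE !aut_le; split=> //; apply: HK.
Qed.

Definition cyc f h := exists n, h = zexpg f n.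

Lemma subg_cyc f : subg (cyc f).
Proof.
split=> [|_ _ [m ->] [n ->]|_ [n ->]]; first by exists 0%R.
- by exists (m + n)%R; rewrite zexpgD.
- by exists (- n)%R; rewrite zexpgN.
Qed.

Lemma cyc_gen f : cyc f f. Proof. by exists 1%R; rewrite zexpg1. Qed.

Lemma cycV f h : cyc (f^-1)%g h <-> cyc f h.
Proof.
by split=> -[n ->]; exists (- n)%R; rewrite zexpgV ?opprK.
Qed.

Lemma orb_cycV f x y : orb (cyc (f^-1)%g) x y <-> orb (cyc f) x y.
Proof.
by split=> -[h [k [Hh Hk ? ?]]]; exists h, k; split=> //; apply/cycV.
Qed.

Lemma orb_cyc_conj f c x y :
  orb (cyc (conjl c f)) (c x) (c y) <-> orb (cyc f) x y.
Proof.
split; last by apply: orb_image => _ [n ->]; exists n; rewrite zexpg_conj.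
move=> cxy; rewrite -(autK c x) -(autK c y).
apply: orb_image cxy => _ [n ->]; exists n.
by rewrite zexpg_conj /conjl invgK !mulgA mulVg mul1g mulgVK.
Qed.

Section Up.
Variables (f : G) (x : T).
Hypothesis fx : x < f x.

Lemma zexpg_up n : zexpg f n x < zexpg f (n + 1)%R x.
Proof. by rewrite zexpgSr autM aut_lt. Qed.

Lemma zexpg_mono m n : (m <= n)%R -> zexpg f m x <= zexpg f n x.
Proof.
move=> le_mn; rewrite -(subrK m n) addrC zexpgD autM aut_le.
have: (0 <= n - m)%R by rewrite subr_ge0.
case: (n - m)%R => // k _; elim: k => [|k IH]; first by rewrite zexpg0.
by apply: (le_trans IH); rewrite -addn1 PoszD ltW // zexpg_up.
Qed.

Lemma orb_cyc_step y : orb (cyc f) x y ->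
  exists n, zexpg f n x <= y /\ y < zexpg f (n + 1)%R x.
Proof.
move=> [_ [_ [[m ->] [k ->] hm hk]]].
have [||//|n [_ _ Pn Pn1]] :=
  @int_first_failure (fun n => zexpg f n x <= y) m (Num.max m k + 1)%R.
- exact: hm.
- move=> /(lt_le_trans (zexpg_up _)); apply/negP; rewrite -leNgt.
  by apply: (le_trans hk); apply: zexpg_mono; lia.
- by lia.
by exists n; split=> //; rewrite ltNge; apply/negP.
Qed.

Lemma orb_cyc_up y : orb (cyc f) x y -> y < f y.
Proof.
move=> /orb_cyc_step [n [ny yn]]; apply: (lt_le_trans yn).
by rewrite zexpgS autM aut_le.
Qed.

End Up.

Lemma orb_cyc_down f x y : f x < x -> orb (cyc f) x y -> f y < y.
Proof.
move=> fx /orb_cycV/orb_cyc_up; rewrite !aut_ltVr; exact.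
Qed.

Lemma orb_cyc_moved f x y : f x <> x -> orb (cyc f) x y -> f y <> y.
Proof.
move=> /eqP; rewrite neq_lt => /orP[/orb_cyc_down|/orb_cyc_up] fy xy; apply/eqP.
  by rewrite lt_eqF // fy.
by rewrite gt_eqF // fy.
Qed.

(** The condition under which [f] on [S] and the identity off [S] fit together: invariance gives
    bijectivity, and since no point outside [S] lies between [x] and [f x] for [x] in [S], order is
    kept. *)
Definition saturated f (S : T -> Prop) := (forall x, S x <-> S (f x)) /\
  forall x y, S x -> (x <= y <= f x) || (f x <= y <= x) -> S y.

Lemma saturated_orb H f x : subg H -> H f -> saturated f (orb H x).
Proof.
move=> sgH Hf; split=> [y|y z xy]; first by rewrite orb_actE.
have xfy : orb H x (f y) by apply/orb_actE.
by case/orP=> /andP[]; apply: orb_convex.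
Qed.

Lemma saturatedV f S : saturated f S -> saturated (f^-1)%g S.
Proof.
move=> [Sf Sc]; have SV x : S x <-> S ((f^-1)%g x) by rewrite (Sf ((f^-1)%g x)) autVK.
split=> // x y /SV Sx; rewrite orbC => xy; apply: (Sc _ _ Sx).
by rewrite autVK.
Qed.

Definition agree_on (S : T -> Prop) f r :=
  (forall x, S x -> r x = f x) /\ (forall x, ~ S x -> r x = x).

Lemma restrict f S : saturated f S -> exists r, agree_on S f r.
Proof.
move=> satS; pose F (g : G) x := if pselect (S x) is left _ then g x else x.
have FT g x : S x -> F g x = g x by rewrite /F; case: pselect.
have FN g x : ~ S x -> F g x = x by rewrite /F; case: pselect.
have FK g : saturated g S -> cancel (F g) (F (g^-1)%g).
  move=> [Sg _] x; have [Sx|Sx] := pselect (S x); last by rewrite !FN ?FN.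
  by rewrite !FT ?FT ?autK // -Sg.
have FK' : cancel (F (f^-1)%g) (F f).
  by have := FK _ (saturatedV satS); rewrite invgK.
have [|r rE] := build_aut (FK _ satS) FK'; last first.
  by exists r; split=> x Sx; rewrite rE; [apply: FT|apply: FN].
case: satS => Sf Sc x y xy.
have [Sx|Sx] := pselect (S x); have [Sy|Sy] := pselect (S y).
- by rewrite !FT ?aut_le.
- rewrite FT ?FN // leNgt; apply/negP => yfx; apply: Sy; apply: (Sc _ _ Sx).
  by rewrite xy (ltW yfx).
- rewrite FN ?FT // leNgt; apply/negP => yfx; apply: Sx; apply: (Sc _ _ Sy).
  by rewrite xy (ltW yfx) orbT.
- by rewrite (FN _ _ Sx) (FN _ _ Sy).
Qed.

Lemma agree_moved S f r x : agree_on S f r -> r x <> x <-> S x /\ f x <> x.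
Proof.
move=> [rS rN]; split=> [rx|[Sx]]; last by rewrite rS.
by have [Sx|/rN//] := pselect (S x); rewrite -rS.
Qed.

Lemma eq_on_zexp S f r x n : saturated f S -> (forall y, S y -> r y = f y) ->
  S x -> zexpg r n x = zexpg f n x /\ S (zexpg f n x).
Proof.
move=> satS rS Sx; have [SfV _] := saturatedV satS; case: (satS) => Sf _.
elim/int_step_ind: n => [//|n [IH Sn]|n [IH Sn]].
  by rewrite !zexpgS !autM IH rS // -Sf.
rewrite !zexpgP !autM IH -SfV; split=> //; apply: (@aut_inj r).
by rewrite autVK rS ?autVK // -SfV.
Qed.

Lemma eq_on_orb S f r x y : saturated f S -> (forall y, S y -> r y = f y) ->
  S x -> orb (cyc r) x y <-> orb (cyc f) x y.
Proof.
move=> satS rS Sx; have E n := (eq_on_zexp n satS rS Sx).1.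
split=> -[_ [_ [[m ->] [k ->] hm hk]]].
  by exists (zexpg f m), (zexpg f k); rewrite -!E; split=> //; [exists m|exists k].
by exists (zexpg r m), (zexpg r k); rewrite !E; split=> //; [exists m|exists k].
Qed.

End Basics.

(** * Piecewise automorphisms *)

Section Tilings.
Variables (d : Order.disp_t) (T : orderType d).
Local Notation G := (order_aut T).
Implicit Types (f g h r u : G) (x y z : T) (L : int -> T -> Prop) (c : int -> G).
Local Open Scope order_scope.

(** A nondecreasing sequence of cuts indexed by the integers. Cuts are lower sets and not points,
    since in an order not yet known to be complete they may be gaps. *)
Record chain L : Prop := Chain {
  chain_down : forall n x y, L n y -> x <= y -> L n x;
  chain_step : forall n x, L n x -> L (n + 1)%R x }.

Lemma chain_mono L m n x : chain L -> (m <= n)%R -> L m x -> L n x.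
Proof.
move=> [_ Ls] le_mn Lm; have [k ->] : exists k : nat, n = (m + k%:Z)%R.
  by exists `|n - m|%N; lia.
elim: k => [|k IH]; first by rewrite addr0.
by rewrite -addn1 PoszD addrA; apply: Ls.
Qed.

Definition outside L x := (forall n, L n x) \/ (forall n, ~ L n x).

Definition in_tile L n x := L (n + 1)%R x /\ ~ L n x.

Lemma tileP L x : chain L -> (exists n, in_tile L n x) \/ outside L x.
Proof.
move=> chL; have [?|/existsNP[m Lm]] := pselect (forall n, L n x); first by right; left.
have [?|/existsNP[k /contrapT Lk]] := pselect (forall n, ~ L n x); first by right; right.
have le_mk : (m <= k)%R.
  by rewrite leNgt; apply/negP => /ltW /(chain_mono chL) /(_ Lk).
have LkN : ~ ~ L k x by apply.
have [j [_ _ Lj /contrapT Lj1]] := @int_first_failure (fun n => ~ L n x) _ _ Lm LkN le_mk.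
by left; exists j.
Qed.

Lemma in_tile_uniq L m n x : chain L -> in_tile L m x -> in_tile L n x -> m = n.
Proof.
move=> chL; wlog: m n / (m < n)%R => [W|mn [Lm _] [_ Ln]].
  by case: (ltgtP m n) => // ?; [|move=> ? ?; symmetry]; apply: W.
by case: Ln; apply: (chain_mono chL) Lm; lia.
Qed.

Lemma in_tile_outside L n x : in_tile L n x -> outside L x -> False.
Proof. by move=> [L1 L0] [/(_ n)|/(_ (n + 1)%R)]. Qed.

Definition piecewise L c (F : T -> T) :=
  (forall n x, in_tile L n x -> F x = c n x) /\ (forall x, outside L x -> F x = x).

Lemma piecewise_ex L c : chain L -> exists F, piecewise L c F.
Proof.
move=> chL; pose P x y := (forall n, in_tile L n x -> y = c n x) /\ (outside L x -> y = x).
have /choice[F FP] : forall x, exists y, P x y.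
  move=> x; case: (tileP x chL) => [[n Ln]|ox].
    exists (c n x); split=> [m Lm|/(in_tile_outside Ln)//].
    by rewrite (in_tile_uniq chL Ln Lm).
  by exists x; split=> // n /in_tile_outside/(_ ox).
by exists F; split=> [n x nx|x ox]; [exact: (FP x).1|exact: (FP x).2].
Qed.

(** [c n] carries both ends of the n-th tile of [L] to those of [L']. The last two fields make the
    two chains leave the same points untiled, so that the identity can be used there. *)
Record tiling L L' c : Prop := Tiling {
  tiling_l : chain L; tiling_r : chain L';
  tiling_lo : forall n x, L n x <-> L' n (c n x);
  tiling_hi : forall n x, L (n + 1)%R x <-> L' (n + 1)%R (c n x);
  tiling_above : forall x, (forall n, ~ L n x) <-> (forall n, ~ L' n x);
  tiling_below : forall x, (forall n, L n x) <-> (forall n, L' n x) }.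

Lemma tilingV L L' c : tiling L L' c -> tiling L' L (fun n => (c n)^-1)%g.
Proof.
case=> chL chL' lo hi ab be; split=> // [n x|n x|x|x].
- by rewrite lo autVK.
- by rewrite hi autVK.
- by rewrite ab.
- by rewrite be.
Qed.

Lemma tiling_outside L L' c x : tiling L L' c -> outside L x <-> outside L' x.
Proof.
by case=> _ _ _ _ ab be; split=> -[] H; (by left; apply/be) || by right; apply/ab.
Qed.

Lemma tiling_tile L L' c n x : tiling L L' c -> in_tile L n x <-> in_tile L' n (c n x).
Proof. by case=> _ _ lo hi _ _; rewrite /in_tile hi (lo n). Qed.

Lemma tiling_piecewise L L' c F n x : tiling L L' c -> piecewise L c F ->
  L n x <-> L' n (F x).
Proof.
move=> tL [FT FO]; case: (tL) => chL chL' lo hi ab be; case: (tileP x chL) => [[m mx]|ox].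
  have /(tiling_tile _ _ tL) mFx := mx; rewrite (FT _ _ mx).
  case: mx mFx => Lm1 Lm [L'm1 L'm]; have [le_nm|lt_mn] := leP n m.
    by split=> /(chain_mono _ le_nm) H; [case: Lm|case: L'm]; apply: H.
  have le_mn : (m + 1 <= n)%R by lia.
  by split=> _; exact: chain_mono le_mn _.
rewrite FO //; case: ox => H; [have /be H' := H|have /ab H' := H].
  by split=> _; [exact: H'|exact: H].
by split=> [/H|/H'].
Qed.

(** The inverse is glued from the inverse tiling. For monotonicity, two points separated by some
    [L n] have images separated by [L' n]; otherwise both lie in one tile or both outside, where a
    single automorphism acts. *)
Lemma tile_aut L L' c : tiling L L' c -> exists f : G, piecewise L c f.
Proof.
move=> tL; have tL' := tilingV tL; case: (tL) => chL chL' _ _ _ _.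
have FK M M' (e : int -> G) F F' : tiling M M' e -> piecewise M e F ->
    piecewise M' (fun n => (e n)^-1)%g F' -> cancel F F'.
  move=> tM [FT FO] [F'T F'O] x; case: (tileP x (tiling_l tM)) => [[n nx]|ox].
    by rewrite (FT _ _ nx) (F'T n) ?autK // -(tiling_tile _ _ tM).
  by rewrite FO // F'O // -(tiling_outside _ tM).
have [F FP] := piecewise_ex c chL; have [F' F'P] := piecewise_ex (fun n => (c n)^-1)%g chL'.
have [] := build_aut (FK _ _ _ _ _ tL FP F'P) _.
- apply: (FK _ _ _ _ _ tL' F'P).
  by have -> // : (fun n => ((c n)^-1)^-1)%g = c; apply/funext => n; rewrite invgK.
- move=> x y xy; have [[n [Lx Ly]]|sep] := pselect (exists n, L n x /\ ~ L n y).
    rewrite leNgt; apply/negP => /ltW yx; apply: Ly.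
    apply/(tiling_piecewise _ _ tL FP); apply: (chain_down chL' _ yx).
    exact/(tiling_piecewise _ _ tL FP).
  have same n : L n x <-> L n y.
    split=> [Lx|Ly]; last exact: (chain_down chL Ly).
    by apply: contrapT => Ly; apply: sep; exists n.
  case: FP => FT FO; case: (tileP x chL) => [[n nx]|ox].
    rewrite (FT _ _ nx) (FT n) ?aut_le //; case: nx => L1 L0.
    by split; rewrite -same.
  rewrite !FO //; case: ox => H; [left|right] => n; last by rewrite -same.
  by rewrite -same.
- move=> f fE; exists f; case: FP => FT FO.
  by split=> [n x nx|x ox]; rewrite fE; [exact: FT|exact: FO].
Qed.

(** [U] is the infinite product of the conjugates of [u] by powers of [g], whose supports are
    pairwise disjoint, obtained by gluing along the cuts [z < zexpg g n x]. *)
Lemma periodic_ext g u x : x < g x ->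
  (forall z, u z <> z -> x <= z /\ z < g x) ->
  exists U : G, [/\ (U * g = g * U)%g, forall z, x <= z -> z < g x -> U z = u z
    & forall z, U z <> z -> exists n, [/\ x <= zexpg g n z, zexpg g n z < g x &
      u (zexpg g n z) <> zexpg g n z]].
Proof.
move=> gx ux; pose L (n : int) z := z < zexpg g n x; pose c n := conjl (zexpg g n) u.
have u_in z : u z <> z -> (x <= u z) /\ (u z < g x).
  by move=> uz; apply: ux => /aut_inj.
have ux0 z : (u z < x) = (z < x).
  have [->//|uz] := pselect (u z = z).
  by rewrite !ltNge; case: (u_in _ uz) (ux _ uz) => -> _ [-> _].
have ux1 z : (u z < g x) = (z < g x).
  by have [->//|uz] := pselect (u z = z); case: (u_in _ uz) (ux _ uz) => _ -> [_ ->].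
have cE n z : c n z = zexpg g n (u (zexpg g (- n)%R z)) by rewrite zexpgN.
have lo n z : L n z <-> z < zexpg g n x by [].
have lo' n z : L n z <-> zexpg g (- n)%R z < x by rewrite zexpgN aut_ltV.
have hi' n z : L (n + 1)%R z <-> zexpg g (- n)%R z < g x.
  by rewrite zexpgN aut_ltV /L zexpgSr.
have chL : chain L.
  split=> [n y z Lz yz|n z Lz]; first exact: le_lt_trans Lz.
  by apply: lt_trans Lz _; apply: zexpg_up.
have cK n z : zexpg g (- n)%R (c n z) = u (zexpg g (- n)%R z) by rewrite cE zexpgN autK.
have [|U [UT UO]] := @tile_aut L L c.
  by split=> // n z; [rewrite !lo' cK ux0|rewrite !hi' cK ux1].
have tileE n z : in_tile L n z <-> x <= zexpg g (- n)%R z /\ zexpg g (- n)%R z < g x.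
  rewrite /in_tile hi' lo' leNgt; split=> [[-> /negP]|[/negP]] //.
exists U; split=> [|z xz zg|z Uz].
- apply: order_aut_eq => z; rewrite !autM.
  have sh n : in_tile L n z -> in_tile L (n + 1)%R (g z).
    have -> // : in_tile L (n + 1)%R (g z) <-> in_tile L n z.
    by rewrite !tileE -autM -zexpgSr; have -> : (- (n + 1) + 1 = - n)%R by lia.
  case: (tileP z chL) => [[n nz]|oz].
    by rewrite (UT _ _ nz) (UT _ _ (sh _ nz)) /c /conjl !autM zexpgS invgM !autM autK.
  rewrite !UO // /outside.
  case: oz => H; [left|right] => n; have := H (n - 1)%R;
    by rewrite /L -{2}(subrK 1%R n) zexpgS autM aut_lt.
- have nz : in_tile L 0 z by apply/tileE; rewrite oppr0.
  by rewrite (UT _ _ nz) cE oppr0.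
- case: (tileP z chL) => [[n nz]|/UO//]; exists (- n)%R; have /tileE[? ?] := nz; split=> //.
  by move: Uz; rewrite (UT _ _ nz) => Uz e; apply: Uz; rewrite cE e zexpgN autVK.
Qed.

End Tilings.

(** * Disjoint supports *)

Lemma commut_mulr (G : groupType) (a b k : G) :
  (a * k = k * a -> commut a (b * k) = commut a b)%g.
Proof.
move=> ak; have aVk : (a^-1 * k^-1 = k^-1 * a^-1)%g by rewrite -!invgM ak.
by rewrite /commut invgM !mulgA -(mulgA _ a^-1 k^-1)%g aVk mulgA mulgK.
Qed.

Section Supports.
Variables (d : Order.disp_t) (T : orderType d).
Local Notation G := (order_aut T).
Implicit Types (a b c f g h k p q r u w : G) (x y z v : T).
Local Open Scope order_scope.

Definition apart f g := forall x, f x <> x -> g x = x.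

Lemma apart_sym f g : apart f g -> apart g f.
Proof. by move=> fg x gx; apply: contrapT => /fg. Qed.

Lemma apart_commute f g : apart f g -> (f * g = g * f)%g.
Proof.
move=> fg; apply: order_aut_eq => x; rewrite !autM.
have [fx|fx] := pselect (f x = x); last by rewrite !fg // => /aut_inj.
rewrite fx; apply: contrapT => fgx; have /aut_inj gx := fg _ fgx.
by apply: fgx; rewrite gx.
Qed.

Lemma aut_sq_fix f x : f (f x) = x -> f x = x.
Proof.
move=> ffx; case: (ltgtP (f x) x) => // fx; exfalso.
  by have := lt_trans (etrans (aut_lt f _ _) fx) fx; rewrite ffx ltxx.
by have := lt_trans fx (etrans (aut_lt f _ _) fx); rewrite ffx ltxx.
Qed.

Lemma inverted_noncommuting a b x : a x <> x -> (b * a = a^-1 * b)%g ->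
  (a * b <> b * a)%g.
Proof.
move=> ax ba ab; apply: ax; apply: aut_sq_fix.
have /mulIg aV : (a * b = a^-1 * b)%g by rewrite ab.
by rewrite {1}aV autK.
Qed.

Lemma fixM f g x : f x = x -> g x = x -> (f * g)%g x = x.
Proof. by rewrite autM => fx ->. Qed.

Lemma movedM f g x : (f * g)%g x <> x -> f x <> x \/ g x <> x.
Proof.
move=> fgx; have [fx|] := pselect (f x = x); last by left.
by right=> gx; apply/fgx/fixM.
Qed.

Lemma movedV f x : (f^-1)%g x <> x -> f x <> x.
Proof. by move=> fx; rewrite -autV_fixE. Qed.

Definition supp_in f x y := forall z, f z <> z -> x < z < y.

Lemma supp_inM f g x y : supp_in f x y -> supp_in g x y -> supp_in (f * g)%g x y.
Proof. by move=> sf sg z /movedM[/sf|/sg]. Qed.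

Lemma supp_inV f x y : supp_in f x y -> supp_in (f^-1)%g x y.
Proof. by move=> sf z /movedV/sf. Qed.

Lemma conjl_moved f c x : conjl c f x <> x <-> f ((c^-1)%g x) <> (c^-1)%g x.
Proof. by split=> H e; apply: H; apply/conjl_fix. Qed.

Lemma supp_in_conj f c x y : supp_in f x y -> supp_in c x y -> supp_in (conjl c f) x y.
Proof. by move=> sf sc; apply: supp_inM; [exact: supp_inM|exact: supp_inV]. Qed.

(** Take for [v] whichever of [f x] and its preimage counterpart lies above [x]: the translates of
    this interval by powers of [f] are consecutive. *)
Lemma wandering f x : f x <> x -> exists v, x < v /\
  forall (n : int) z, x < z < v -> x < zexpg f n z < v -> n = 0%R.
Proof.
wlog: f / x < f x => [W|fx _].
  move=> fx'; case: (ltgtP x (f x)) => fx; [exact: W| |by case: fx'].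
  have [||v [xv vE]] := W (f^-1)%g.
  - by rewrite aut_ltVr.
  - by move/autV_fixE.
  exists v; split=> // n z xz nz; apply: oppr_inj.
  by apply: (vE (- n)%R z xz); rewrite zexpgV opprK.
exists (f x); split=> // n z /andP[xz zf] /andP[nx nz].
case: (ltgtP n 0%R) => // n0.
  have : zexpg f n z < zexpg f 0%R x.
    have : zexpg f n z < zexpg f n (f x) by rewrite aut_lt.
    move=> /lt_le_trans; apply; rewrite -autM -zexpgSr.
    by apply: zexpg_mono => //; lia.
  by move=> /(lt_trans nx); rewrite ltxx.
have : zexpg f 1%R x < zexpg f n z.
  apply: (le_lt_trans (y := zexpg f n x)); last by rewrite aut_lt.
  by apply: zexpg_mono => //; lia.
by rewrite zexpg1 => /lt_trans/(_ nz); rewrite ltxx.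
Qed.

Definition flexible := forall x y, x < y ->
  exists u : G, supp_in u x y /\ exists z, u z <> z.

Hypothesis flexT : flexible.

Lemma flexible_dense x y : x < y -> exists2 z, x < z & z < y.
Proof. by move=> /flexT[u [su [z /su/andP[? ?]]]]; exists z. Qed.

(* Two distinct elements [b], [q] with [b ^ 2 = q ^ 2] generate a Klein bottle
   group; [q] is the conjugate of [b] by a [b ^ 2]-periodic element. *)
Lemma flexible_klein x y : x < y -> exists a b, [/\ supp_in a x y, supp_in b x y,
  exists z, a z <> z & (b * a = a^-1 * b)%g].
Proof.
move=> xy; have [b [z [sb zb]]] : exists b z, supp_in b x y /\ z < b z.
  have [u [su [z uz]]] := flexT xy; case: (ltgtP z (u z)) => zu; last by case: uz.
    by exists u, z.
  by exists (u^-1)%g, z; split; [exact: supp_inV|rewrite aut_ltVr].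
have [u [su [p up]]] := flexT zb; have /andP[zp pb] := su _ up.
have zbb : z < (b * b)%g z by rewrite autM (lt_trans zb) // aut_lt.
(* [u] lives between [z] and [b z], half of a period of [b * b]. So [C] moves [p] but fixes [b p]:
   it commutes with [b * b] and not with [b], which gives [q <> b] with the same square. *)
have [|C [Cb CE suppC]] := @periodic_ext _ _ (b * b)%g u z zbb.
  move=> w /su/andP[zw wb]; split; first exact: ltW.
  by apply: (lt_trans wb); rewrite autM aut_lt.
have sC : supp_in C x y.
  move=> w /suppC[n [_ _ /su wn]]; apply: sb => bw.
  have := wn; have -> : zexpg (b * b)%g n w = w.
    elim/int_step_ind: n {wn} => // n IH; first by rewrite zexpgS !autM IH !bw.
    by rewrite zexpgP invgM !autM IH !(autV_fix bw).
  move=> /andP[zw wbz]; rewrite -bw -[X in _ < X]/(b z) in wbz.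
  by move: wbz; rewrite aut_lt => /(lt_trans zw); rewrite ltxx.
have bp : z <= b p by rewrite ltW // (lt_trans zp) // (lt_trans pb) // aut_lt.
have Cbp : C (b p) = b p.
  rewrite CE //; last by rewrite autM aut_lt.
  by apply: contrapT => /su /andP[_]; rewrite aut_lt => /(lt_trans zp); rewrite ltxx.
pose q := conjl C b.
have qq : (q * q = b * b)%g.
  by rewrite /q /conjl !mulgA mulgVK -(mulgA C) Cb mulgK.
have qb : q <> b.
  move=> /(congr1 (fun f => (f * C)%g p)); rewrite /q /conjl mulgVK !autM Cbp.
  move=> /aut_inj; rewrite CE; [by move/esym| exact: ltW|]; apply: (lt_trans pb).
  by rewrite autM aut_lt.
have sq : supp_in q x y by apply: supp_in_conj.
exists (b * q^-1)%g, b; clearbody q; split=> //.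
- by apply: supp_inM => //; apply: supp_inV.
- by apply: aut_moves => /divg1_eq/esym.
- by rewrite invgM invgK mulgVK mulgA -qq mulgK.
Qed.

(* If f and g both move x, take h = u supported in a wandering interval V of x.
   The element commut f1 (commut f2 u) of C(g) moves only points in four translates
   of V by elements of C(g), each meeting a g-orbit at most once; so its g-invariant
   support contains no g-orbit and is empty. *)
Lemma disjP f g : disj f g <-> apart f g.
Proof.
split=> [D x fx|fg h fh].
  apply: contrapT => gx; have [v1 [xv1 V1]] := wandering fx.
  have [v2 [xv2 V2]] := wandering gx; pose v := Order.min v1 v2.
  have inV z : x < z < v -> (x < z < v1) /\ (x < z < v2).
    by rewrite /v lt_min => /and3P[-> -> ->].
  have [|u [su [z0 uz0]]] := flexT (x := x) (y := v); first by rewrite lt_min xv1.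
  have [|f1 [f2 [f1g [f2g [k1 kg]]]]] := D u.
    move=> /(congr1 (fun k : G => k z0)); rewrite !autM.
    have -> : u (f z0) = f z0.
      apply: contrapT => /su/inV[fz0 _]; have /inV[z0V _] := su _ uz0.
      by have := V1 1%R _ z0V; rewrite zexpg1 => /(_ fz0).
    by move=> /aut_inj.
  have [p kp] := aut_moves k1; pose c := nth 1%g [:: 1%g; f1; f2; f1 * f2]%g.
  have cg i n : (zexpg g n * (c i)^-1 = (c i)^-1 * zexpg g n)%g.
    apply/esym/zexpg_commute/esym/commuteV.
    case: i => [|[|[|[|i]]]] //=; try exact: commute1.
      by apply: commuteM; rewrite /commute.
    by rewrite /c /= nth_nil; apply: commute1.
  have moved (t : T) : commut f1 (commut f2 u) t <> t ->
      exists i : 'I_4, x < ((c i)^-1)%g t < v.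
    have -> : commut f1 (commut f2 u) =
        (conjl (f1 * f2) u * conjl f1 u^-1 * (u * conjl f2 u^-1))%g.
      by rewrite /commut /conjl !invgM !invgK !mulgA !mulgVK.
    case/movedM => /movedM[].
    - by move=> /conjl_moved/su; exists (inord 3); rewrite inordK.
    - by move=> /conjl_moved/movedV/su; exists (inord 1); rewrite inordK.
    - by move=> /su; exists ord0; have -> : ((c (@ord0 3))^-1 = 1)%g by exact: invg1.
    - by move=> /conjl_moved/movedV/su; exists (inord 2); rewrite inordK.
  (* Pigeonhole: the five points [p], ..., [zexpg g 4 p] are all moved by an element commuting with
     [g], but there are only four translates to hold them. *)
  have /choice[i iP] : forall n : 'I_5, exists i : 'I_4,
      x < ((c i)^-1)%g (zexpg g (n : nat)%:Z p) < v.
    move=> n; apply: moved; rewrite -autM.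
    by rewrite zexpg_commute // autM => /aut_inj.
  suff /leq_card : injective i by rewrite !card_ord.
  move=> m n imn; have := iP m; have := iP n; rewrite -imn -!autM -!cg !autM.
  set t := ((c (i m))^-1)%g p => /inV[_ tn] /inV[_ tm]; apply: val_inj => /=.
  have := V2 ((n : nat)%:Z - (m : nat)%:Z)%R _ tm; rewrite -autM -zexpgD subrK => /(_ tn).
  by lia.
(* Near a point moved by both [f] and [h], [g] is trivial, so a Klein pair [a], [b] supported there
   lies in the centralizer of [g]. As [h] moves that interval off itself, [commut b h] is [b] times
   an element commuting with [a], and the double commutator collapses to [commut a b]. *)
have [x [fx hx]] : exists x, f x <> x /\ h x <> x.
  apply: contrapT => nx; apply: fh; apply: apart_commute => x fx.
  by apply: contrapT => hx; apply: nx; exists x.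
have [v1 [xv1 V1]] := wandering fx; have [v2 [xv2 V2]] := wandering hx.
pose v := Order.min v1 v2.
have inV z : x < z < v -> (x < z < v1) /\ (x < z < v2).
  by rewrite /v lt_min => /and3P[-> -> ->].
have [|a [b [sa sb [z az] ba]]] := @flexible_klein x v; first by rewrite lt_min xv1.
have fV y : x < y < v -> f y <> y.
  move=> /inV[yV _] fy; have := V1 1%R _ yV; rewrite zexpg1 fy => /(_ yV).
  by [].
have ag : (a * g = g * a)%g by apply: apart_commute => y /sa/fV/fg.
have bg : (b * g = g * b)%g by apply: apart_commute => y /sb/fV/fg.
have aE : commut a (commut b h) = commut a b.
  have ab' : (a * conjl h b^-1 = conjl h b^-1 * a)%g.
    apply: apart_commute => y /sa/inV[_ yV]; apply: contrapT => /conjl_moved/movedV/sb/inV[_ hyV].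
    have := V2 1%R _ hyV; rewrite zexpg1 autVK => /(_ yV).
    by [].
  have -> : commut b h = (b * conjl h b^-1)%g by rewrite /commut /conjl !mulgA.
  exact: commut_mulr.
exists a, b; rewrite aE; split=> //; split=> //; split.
  move=> /(congr1 (fun k => k * b * a)%g); rewrite /commut mulgVK mulgVK mul1g.
  exact: (inverted_noncommuting az ba).
by apply/esym; do ![apply: commuteM|apply: commuteV]; apply/esym.
Qed.

End Supports.

(** * Bumps and half-lines *)

Section Bumps.
Variables (d : Order.disp_t) (T : orderType d).
Local Notation G := (order_aut T).
Implicit Types (a b c f g h k p q r u w : G) (x y z v : T).
Local Open Scope order_scope.

Definition one_orbital f x := f x <> x /\ forall y, f y <> y -> orb (cyc f) x y.

Lemma one_orbital_moved f x y : one_orbital f x -> f y <> y <-> orb (cyc f) x y.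
Proof. by case=> fx fO; split=> [/fO//|]; apply: orb_cyc_moved. Qed.

Lemma one_orbital_conj c f x : one_orbital f x -> one_orbital (conjl c f) (c x).
Proof.
move=> [fx fO]; split=> [|y /conjl_moved/fO]; first by rewrite conjlE => /aut_inj.
by rewrite -(orb_cyc_conj f c) autVK.
Qed.

Lemma one_orbital_convex f x0 x y z : one_orbital f x0 -> f x <> x -> f z <> z ->
  x <= y -> y <= z -> f y <> y.
Proof.
move=> fO; rewrite !(one_orbital_moved _ fO); apply: orb_convex.
Qed.

Lemma one_orbital_V f x : one_orbital f x -> one_orbital (f^-1)%g x.
Proof.
move=> [fx fO]; split=> [/autV_fixE//|y /movedV/fO]; exact: (orb_cycV f x y).2.
Qed.

Lemma orbital_restrict f x : f x <> x ->
  exists2 r : G, one_orbital r x & agree_on (orb (cyc f) x) f r.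
Proof.
move=> fx; have sat := saturated_orb x (subg_cyc f) (cyc_gen f).
have [r rP] := restrict sat; exists r => //; have xx := orb_refl (subg_cyc f) x.
split=> [|y /(agree_moved _ rP)[xy _]]; first by rewrite rP.1.
by apply/(eq_on_orb _ sat rP.1).
Qed.

(** On the [p]-orbital of [x] the factor [r] is trivial and [f] agrees with [p], so this is also the
    [f]-orbital: a disjoint factorization distributes whole orbitals. *)
Lemma apart_orb f p r x y : f = (p * r)%g -> apart p r -> p x <> x ->
  orb (cyc f) x y -> p y <> y.
Proof.
move=> fE pr px; have sat := saturated_orb x (subg_cyc p) (cyc_gen p).
have xx := orb_refl (subg_cyc p) x.
have eqfp z : orb (cyc p) x z -> f z = p z.
  by move=> /(orb_cyc_moved px)/pr rz; rewrite fE autM rz.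
by move=> /(eq_on_orb _ sat eqfp xx)/(orb_cyc_moved px).
Qed.

Hypothesis flexT : flexible T.

(** Cutting [f] down to one orbital splits it into disjoint factors, so indecomposability leaves no
    other orbital; conversely [apart_orb] gives a single orbital entirely to one factor. *)
Lemma is_bumpP f : is_bump f <-> exists x, one_orbital f x.
Proof.
split=> [[f1 fI]|[x fO]].
  have [x fx] := aut_moves f1; exists x; split=> //.
  have [p pO pP] := orbital_restrict fx.
  have pr : apart p (p^-1 * f)%g.
    move=> y /(agree_moved _ pP)[Sy _]; rewrite autM -pP.1 // autK //.
  have [||p1|r1] := fI p (p^-1 * f)%g; first by rewrite mulgA mulgV mul1g.
  - exact/(disjP flexT).
  - by case: pO; rewrite p1.
  have := mulg1_eq r1; rewrite invgK => <-.
  by case: pO.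
have f1 : f <> 1%g by apply: (@aut_neq1 _ _ _ x); case: fO.
split=> // p r fE /(disjP flexT) pr.
wlog: p r fE pr / p x <> x => [W|px].
  have [px|/W] := pselect (p x = x); last exact.
  have [rx|rx] := pselect (r x = x); first by case: fO; rewrite fE autM rx px.
  have rp : apart r p by apply: apart_sym.
  by case: (W r p) => //; [rewrite fE; apply: apart_commute|right|left].
right; apply: contrapT => /aut_moves[y ry]; have py := apart_sym pr ry.
have fy : f y <> y.
  by rewrite fE autM (apart_sym pr) // => /aut_inj.
by case: fO => _ /(_ _ fy) /(apart_orb fE pr px).
Qed.

Lemma supp_le_apart f k : supp_le f k <-> forall h, apart h k -> apart h f.
Proof. by split=> H h; [move/(disjP flexT)/H/(disjP flexT)|move/(disjP flexT)/H/(disjP flexT)]. Qed.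

(** If [f] moves [z] and [k] does not, the convex support of [k] lies on one side of [z]. On the
    other side there is an interval moved by [f] and fixed by [k], and an automorphism supported in
    it refutes [supp_le]. *)
Lemma supp_leP f k x y : one_orbital f x -> one_orbital k y ->
  supp_le f k <-> forall z, f z <> z -> k z <> z.
Proof.
move=> fO kO; rewrite supp_le_apart; split=> [fk z fz kz|fk h hk w hw].
  suff [a [b [ab fab kab]]] : exists a b : T, [/\ a < b, forall w : T, a <= w -> w <= b -> f w <> w
      & forall w : T, a < w -> w < b -> k w = w].
    have [u [su [w uw]]] := flexT ab; have /andP[aw wb] := su _ uw.
    case: (fab _ (ltW aw) (ltW wb)); apply: (fk u) => // v /su/andP[]; exact: kab.
  have [a [b [az zb fa fb]]] : exists a b : T, [/\ a < z, z < b, f a <> a & f b <> b].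
    have fVz : f ((f^-1)%g z) <> (f^-1)%g z.
      by rewrite autVK => e; apply: fz; rewrite {1}e autVK.
    have ffz : f (f z) <> f z by move/aut_inj.
    case: (ltgtP z (f z)) => zf; last by case: fz.
      by exists ((f^-1)%g z), (f z); split=> //; rewrite aut_ltV.
    by exists (f z), ((f^-1)%g z); split=> //; rewrite aut_ltVr.
  have [side|side] : (forall w : T, k w <> w -> w < z) \/ (forall w : T, k w <> w -> z < w).
    have ky := kO.1; case: (ltgtP y z) => yz; last by case: ky; rewrite yz.
      left=> w kw; rewrite ltNge; apply/negP => zw.
      by have := one_orbital_convex kO ky kw (ltW yz) zw.
    right=> w kw; rewrite ltNge; apply/negP => zw.
    by have := one_orbital_convex kO kw ky zw (ltW yz).
  - exists z, b; split=> // [w zw wb|w zw wb]; first exact: (one_orbital_convex fO fz fb).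
    by apply: contrapT => /side /(lt_trans zw); rewrite ltxx.
  - exists a, z; split=> // [w zw wb|w zw wb]; first exact: (one_orbital_convex fO fa fz).
    by apply: contrapT => /side /(lt_trans wb); rewrite ltxx.
by apply: contrapT => /fk/(apart_sym hk)/hw.
Qed.

Lemma half_lineP f g x : one_orbital f x -> half_line g f <->
  (forall z, f z <> z -> f ((g^-1)%g z) <> (g^-1)%g z) /\
  exists z, f z = z /\ f ((g^-1)%g z) <> (g^-1)%g z.
Proof.
move=> fO; have cO := one_orbital_conj g fO.
have fB : is_bump f by apply/is_bumpP; exists x.
have gP z : conjl g f z <> z <-> f ((g^-1)%g z) <> (g^-1)%g z by rewrite conjl_moved.
rewrite /half_line (supp_leP fO cO) (supp_leP cO fO); split=> [[_ [H1 H2]]|[H1 [z [z1 z2]]]].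
  split=> [z /H1/gP//|]; apply: contrapT => H3; apply: H2 => z /gP z2 z1.
  by apply: H3; exists z.
split=> //; split=> [z' /H1/gP//|/(_ z)]; rewrite gP => /(_ z2).
by rewrite z1.
Qed.

End Bumps.

(** * From the sentence to small supports *)

Section ConjugateSubgroups.
Variable G : groupType.
Implicit Types (a b c f g h k : G).
Local Open Scope group_scope.

Lemma conjlM c f g : conjl c (f * g) = conjl c f * conjl c g.
Proof. by rewrite /conjl !mulgA mulgVK. Qed.

Lemma conjl1 c : conjl c 1 = 1.
Proof. by rewrite /conjl mulg1 mulgV. Qed.

Lemma conjlV c f : conjl c f^-1 = (conjl c f)^-1.
Proof. by rewrite /conjl !invgM invgK mulgA. Qed.

Lemma conjlK c f : conjl c^-1 (conjl c f) = f.
Proof. by rewrite /conjl invgK !mulgA mulVg mul1g mulgVK. Qed.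

Lemma conjlVK c f : conjl c (conjl c^-1 f) = f.
Proof. by rewrite -{1}(invgK c) conjlK. Qed.

End ConjugateSubgroups.

Section LocallyMoving.
Variables (d : Order.disp_t) (T : orderType d).
Local Notation G := (order_aut T).
Implicit Types (a b c f g h k p q r u : G) (x y z v w s t : T) (H K : G -> Prop).
Local Open Scope order_scope.

Definition gen a b h := forall K, subg K -> K a -> K b -> K h.

Lemma subg_gen a b : subg (gen a b).
Proof.
split=> [K [? ? ?] //|f g Hf Hg K sK Ka Kb|f Hf K sK Ka Kb].
  by have [_ KM _] := sK; apply: KM; [apply: Hf|apply: Hg].
by have [_ _ KV] := sK; apply: KV; apply: Hf.
Qed.

Lemma subg_cent c : subg (fun h => h * c = c * h)%g.
Proof.
split=> [|f g fc gc|f fc]; first by rewrite mul1g mulg1.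
  by rewrite -mulgA gc mulgA fc mulgA.
by apply/esym/commuteV/esym.
Qed.

Lemma subg_conj H c : subg H -> subg (fun h => H (conjl c h)).
Proof.
move=> [H1 HM HV]; split=> [|f g|f]; first by rewrite conjl1.
  by rewrite conjlM; apply: HM.
by rewrite conjlV; apply: HV.
Qed.

Lemma gen_commute a b f h k : commutes_with_conj a b f ->
  gen a b h -> gen a b (conjl f^-1 k)%g -> (h * k = k * h)%g.
Proof.
move=> [aa [ab [ba bb]]] Hh Hk; rewrite -(conjlVK f k); move: (conjl _ k) Hk => {}k Hk.
apply/esym; apply: (Hk (fun k => conjl f k * h = h * conjl f k)%g).
- exact: subg_conj (subg_cent h).
- by apply/esym; apply: (Hh (fun h => h * _ = _ * h)%g) => //; apply: subg_cent.
- by apply/esym; apply: (Hh (fun h => h * _ = _ * h)%g) => //; apply: subg_cent.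
Qed.

(** [k y] is above or below the whole [H]-orbit of [y]; replace [k] by its inverse in the second
    case. Commutation turns [h^-1 y < k y] into [k^-1 y < h y], which gives the other bound. *)
Lemma commuting_escape H K y k : subg K -> (forall h k, H h -> K k -> h * k = k * h)%g ->
  subg H -> K k -> ~ orb H y (k y) -> exists k', [/\ K k',
    forall h, H h -> h y < k' y & forall h, H h -> (k'^-1)%g y < h y].
Proof.
move=> [_ _ KV] HK [_ _ HV] Kk nk.
have [hi|/existsNP[h0 /not_implyP[Hh0 /negP]]] := pselect (forall h, H h -> h y < k y).
  exists k; split=> // h Hh; rewrite aut_ltV -autM -HK // autM.
  by rewrite -aut_ltV; apply: hi; apply: HV.
rewrite -leNgt => kh0; have lo h : H h -> k y < h y.
  by move=> Hh; rewrite ltNge; apply/negP => hk; apply: nk; exists h, h0.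
exists (k^-1)%g; rewrite invgK; split=> // [|h Hh]; first exact: KV.
rewrite aut_ltVr -autM -HK // autM -aut_ltVr.
by apply: lo; apply: HV.
Qed.

(* Commuting groups permute each other's orbitals. With H = <a, b> and
   K = f H f^-1, if the H-orbital A meets f A, then [f] moving points up excludes
   that either orbital is displaced, so A = f A is an orbital of both H and K.
   If moreover [f] fixed A near one of its ends, then moving points there by
   elements of K would show that [a] and [b] commute. *)
Lemma commuting_dichotomy f a b z : (forall x, x <= f x) ->
  commutes_with_conj a b f -> a z <> z -> (b * a = a^-1 * b)%g ->
  let A := orb (gen a b) z in
  (forall y, A y -> ~ A (f y)) \/
  [/\ forall y, A y <-> A (f y), forall t, A t -> exists y, [/\ A y, t <= y & f y <> y]
    & forall t, A t -> exists y, [/\ A y, y <= t & f y <> y]].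
Proof.
move=> fup abf az ba A; pose H := gen a b; pose K h := H (conjl f^-1 h)%g.
have sH : subg H := subg_gen a b; have sK : subg K := subg_conj _ sH.
have HK h k : H h -> K k -> (h * k = k * h)%g by apply: gen_commute.
have [//|/existsNP[y /not_implyP[Ay /contrapT Afy]]] := pselect (forall y, A y -> ~ A (f y)).
  by left.
right; pose C := orb K (f y); have AC x : A x -> C (f x).
  move=> Ax; apply: (@orb_image _ _ H) => [h Hh|]; first by rewrite /K conjlK.
  exact: orb_trans (orb_sym sH Ay) Ax.
have CA x : C x -> A ((f^-1)%g x).
  move=> Cx; apply: (orb_trans sH Ay); rewrite -{1}(autK f y).
  by apply: orb_image Cx => h.
have AH x : A x -> orb H (f y) x by move=> Ax; apply: (orb_trans sH) Ax; apply: (orb_sym sH).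
have HA x : orb H (f y) x -> A x by apply: (orb_trans sH).
(* Otherwise some [k'^-1 (f y)] is below the whole [H]-orbit of [f y]. It lies in [C], so its
   [f]-preimage lies in [A], hence above some point of that orbit; but [f] moves points up, so the
   preimage is no higher. *)
have KA k : K k -> A (k (f y)).
  move=> Kk; apply: contrapT => nA.
  have [|k' [Kk' _ lo]] := commuting_escape sK HK sH Kk (y := f y); first by move/HA.
  have /CA/AH[h [_ [Hh _ hy _]]] : C ((k'^-1)%g (f y)).
    by apply: orb_act; case: sK => _ _; apply.
  have := lo _ Hh; rewrite ltNge => /negP; apply; apply: (le_trans hy).
  by rewrite aut_leV.
(* Symmetrically, a point [h' (f y)] of [A] above the whole [K]-orbit of [f y] would have its image
   under [f] in [C], although that image is at least as high. *)
have HC h : H h -> C (h (f y)).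
  move=> Hh; apply: contrapT => nC.
  have KH k h' : K k -> H h' -> (k * h' = h' * k)%g by move=> Kk Hh'; rewrite (HK _ _ Hh' Kk).
  have [h' [Hh' hi _]] := commuting_escape sH KH sK Hh nC.
  have /AC[_ [k [_ Kk _ ky]]] : A (h' (f y)) by apply/HA/orb_act.
  by have := lt_le_trans (hi _ Kk) (le_trans (fup _) ky); rewrite ltxx.
have AeC x : A x <-> C x.
  split=> [/AH[h [h' [Hh Hh' hx xh]]]|[k [k' [Kk Kk' kx xk]]]].
    exact: (orb_convex (HC _ Hh) (HC _ Hh')).
  exact: (orb_convex (KA _ Kk) (KA _ Kk')).
have Ha : H a by []. have Hb : H b by [].
have sz : orb H z z := orb_refl sH z.
have Az : A z by []. have Aa : A (a z) by apply/orb_actE.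
have Ab : A (b z) by apply/orb_actE. have Aba : A (b (a z)) by apply/orb_actE.
(* Where [f] fixes these four points, [conjl f b] acts on them as [b]. It commutes with [a], so
   [a (b z) = b (a z)]; with the Klein relation [a * a] fixes [b z], hence so does [a], and
   [a z = z]. Below, [k] pushes all four points past [t], into the region fixed by [f]. *)
have contra k : K k -> f (k z) = k z -> f (k (a z)) = k (a z) ->
    f (k (b z)) = k (b z) -> f (k (b (a z))) = k (b (a z)) -> False.
  move=> Kk fz fa fb fba; have Kb : K (conjl f b) by rewrite /K conjlK.
  have comm_k h x : H h -> h (k x) = k (h x) by move=> Hh; rewrite -!autM HK.
  have := congr1 (fun h : G => h (k z)) (HK _ _ Ha Kb).
  rewrite /conjl !autM (autV_fix fz) (comm_k a z Ha) (autV_fix fa).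
  rewrite (comm_k b z Hb) (comm_k b _ Hb) fb fba (comm_k a _ Ha) => /aut_inj.
  rewrite -[b (a z)]/((b * a)%g z) ba autM => /(congr1 a); rewrite autVK => /aut_sq_fix abz.
  by apply: az; apply: (@aut_inj _ _ b); rewrite -autM ba autM (autV_fix abz).
split=> [x|t At|t At].
- by split=> [/AC/AeC|/AeC/CA]; rewrite ?autK.
- apply: contrapT => nt.
  have fix_t x : A x -> t <= x -> f x = x.
    by move=> Ax tx; apply: contrapT => fx; apply: nt; exists x.
  pose m := Order.min (Order.min z (a z)) (Order.min (b z) (b (a z))).
  have Am : A m by rewrite /m !minEle; do !case: ifP.
  have [k Kk tk] : exists2 k, K k & t <= k m.
    apply: (orb_unbounded (x := m)); apply: (orb_trans sK (y := f y)).
      by apply: (orb_sym sK); apply/AeC.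
    exact/AeC.
  have Ak x : A x -> A (k x) by move=> /AeC ?; apply/AeC/orb_actE.
  have tm x : m <= x -> t <= k x by move=> mx; apply: (le_trans tk); rewrite aut_le.
  by apply: (contra k) => //; apply: fix_t; auto; apply: tm; rewrite /m !ge_min lexx ?orbT.
- apply: contrapT => nt.
  have fix_t x : A x -> x <= t -> f x = x.
    by move=> Ax tx; apply: contrapT => fx; apply: nt; exists x.
  pose m := Order.max (Order.max z (a z)) (Order.max (b z) (b (a z))).
  have Am : A m by rewrite /m !maxEle; do !case: ifP.
  have [k Kk tk] : exists2 k, K k & k m <= t.
    apply: (orb_unboundedl (x := m)); apply: (orb_trans sK (y := f y)).
      by apply: (orb_sym sK); apply/AeC.
    exact/AeC.
  have Ak x : A x -> A (k x) by move=> /AeC ?; apply/AeC/orb_actE.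
  have tm x : x <= m -> k x <= t by move=> mx; apply: le_trans tk; rewrite aut_le.
  by apply: (contra k) => //; apply: fix_t; auto; apply: tm; rewrite /m !le_max lexx ?orbT.
Qed.

Definition small_for f u z := one_orbital u z /\ forall y, u y <> y -> u (f y) = f y.

Lemma small_forV f u z : small_for (f^-1)%g u z -> small_for f u z.
Proof.
move=> [uO uf]; split=> // y uy; apply: contrapT => /uf.
by rewrite autK => /uy.
Qed.

Lemma one_orbital_le f x0 : one_orbital f x0 -> x0 < f x0 -> forall x, x <= f x.
Proof.
move=> [_ fO] up x; have [->//|/fO] := pselect (f x = x).
by move=> /(orb_cyc_up up)/ltW.
Qed.

Lemma one_orbital_direction f x0 : one_orbital f x0 ->
  (forall x, x <= f x) \/ (forall x, x <= (f^-1)%g x).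
Proof.
move=> fO; case: (ltgtP x0 (f x0)) => fx; last by case: fO; rewrite -fx.
  by left; apply: one_orbital_le fO _.
by right; apply: (one_orbital_le (one_orbital_V fO)); rewrite aut_ltVr.
Qed.

Lemma commuting_moved f p x : (f * p = p * f)%g -> p x <> x -> p (f x) <> f x.
Proof. by move=> fp px; rewrite -autM -fp autM => /aut_inj. Qed.

Lemma commuting_invariant f p w0 x y : (f * p = p * f)%g -> one_orbital p w0 ->
  p x <> x -> orb (cyc f) x y -> p y <> y.
Proof.
move=> fp pO px [_ [_ [[m ->] [n ->] my yn]]].
have pz (k : int) : p (zexpg f k x) <> zexpg f k x.
  by apply: commuting_moved => //; apply/esym/zexpg_commute/esym.
exact: (one_orbital_convex pO (pz m) (pz n)).
Qed.

Lemma cyc_sub_gen a b z x : orb (cyc a) z x -> orb (gen a b) z x.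
Proof.
have sub (n : int) : gen a b (zexpg a n).
  move=> K [K1 KM KV] Ka _; elim/int_step_ind: n => // n IH.
    by rewrite zexpgS; apply: KM.
  by rewrite zexpgP; apply: KM => //; apply: KV.
by move=> [_ [_ [[m ->] [n ->] ? ?]]]; exists (zexpg a m), (zexpg a n); split.
Qed.

(** [q] moves all points of an orbital in one direction, while [c] turns a point moved up by [q]
    into one moved down, and conversely. *)
Lemma inverter_leaves_orbital c q x : (c * q = q^-1 * c)%g -> q x <> x ->
  ~ orb (cyc q) x (c x).
Proof.
move=> cq qx xc; case: (ltgtP x (q x)) => qx'; last by case: qx.
  have := orb_cyc_up qx' xc; rewrite -aut_ltV -autM -cq autM aut_lt.
  by move=> /(lt_trans qx'); rewrite ltxx.
have := orb_cyc_down qx' xc; rewrite -aut_ltVr -autM -cq autM aut_lt.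
by move=> /lt_trans/(_ qx'); rewrite ltxx.
Qed.

Hypothesis locT : locally_moving G.

Lemma orbital_of_invariant f x0 (A : T -> Prop) s : one_orbital f x0 ->
  (forall x y t, A x -> A y -> x <= t -> t <= y -> A t) -> A s ->
  [/\ forall y, A y <-> A (f y), forall t, A t -> exists y, [/\ A y, t <= y & f y <> y]
    & forall t, A t -> exists y, [/\ A y, y <= t & f y <> y]] ->
  forall y, A y <-> f y <> y.
Proof.
move=> fO Ac As [fA hi lo] y; split=> [Ay|fy].
  have [v [_ yv fv]] := hi _ Ay; have [u [_ uy fu]] := lo _ Ay.
  exact: (one_orbital_convex fO fu fv).
have [w [Aw _ fw]] := hi _ As.
have An (n : int) : A (zexpg f n w).
  elim/int_step_ind: n => // n IH; first by rewrite zexpgS autM -fA.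
  by rewrite zexpgP autM fA autVK.
move: fw fy; rewrite !(one_orbital_moved _ fO) => xw xy.
have := orb_trans (subg_cyc f) (orb_sym (subg_cyc f) xw) xy.
by move=> [_ [_ [[m ->] [n ->] ? ?]]]; apply: Ac (An m) (An n) _ _.
Qed.

(** If [f] displaces the orbital of [gen a b], then [a] cut down to its own orbital inside is small.
    Otherwise that orbital is invariant and meets the support of [f] near both ends, so it equals
    this support. *)
Lemma small_case f x0 a b z : one_orbital f x0 -> (forall x, x <= f x) ->
  commutes_with_conj a b f -> a z <> z -> (b * a = a^-1 * b)%g ->
  (exists u v, small_for f u v) \/ (forall y, orb (gen a b) z y <-> f y <> y).
Proof.
move=> fO fup abf az ba; have sH := subg_gen a b.
have [dis|inv] := commuting_dichotomy fup abf az ba; [left|right].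
  have [u uO uP] := orbital_restrict az; exists u, z; split=> // y.
  move=> /(agree_moved _ uP)[ay _]; apply: contrapT => /(agree_moved _ uP)[afy _].
  by apply: (dis y); apply: cyc_sub_gen.
apply: (orbital_of_invariant fO _ _ inv); last exact: orb_refl.
by move=> x y t; apply: orb_convex.
Qed.

(** [f] and [p] do not commute, as otherwise the support of [p] would contain a whole [f]-orbital
    and with it [s]. Apply [locally_moving] to the pair: were the resulting orbital the support of
    [f], the dichotomy for [p] would fail, since [p] cannot displace a set containing [w] and [p w],
    and its own support misses [s]. *)
Lemma small_of_subbump f x0 p w s : one_orbital f x0 -> one_orbital p w ->
  (forall y, p y <> y -> f y <> y) -> f s <> s -> p s = s ->
  exists u v, small_for f u v.
Proof.
wlog fup : f / forall x, x <= f x => [W|].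
  move=> fO pO pf fs ps; case: (one_orbital_direction fO) => fup; first exact: (W f).
  have [|||u [v uv]] := W _ fup (one_orbital_V fO) pO => //.
  - by move=> y /pf fy /autV_fixE.
  - by move=> /autV_fixE.
  by exists u, v; apply: small_forV.
wlog pup : p / forall x, x <= p x => [W|].
  move=> fO pO pf fs ps; case: (one_orbital_direction pO) => pup; first exact: (W p).
  apply: (W _ pup fO (one_orbital_V pO)) => //; last exact: autV_fix.
  by move=> y /movedV/pf.
move=> fO pO pf fs ps; have [pw _] := pO; have fw := pf _ pw.
have ws : orb (cyc f) w s.
  move: (fs) (fw); rewrite !(one_orbital_moved _ fO) => xs xw.
  exact: (orb_trans (subg_cyc f) (orb_sym (subg_cyc f) xw) xs).
have fp : (f * p <> p * f)%g.
  by move=> fp; case: (commuting_invariant fp pO pw ws).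
have [a [b [/aut_moves[z az] [ba [abf abp]]]]] := locT fp.
have [//|Af] := small_case fO fup abf az ba.
have [dis|inv] := commuting_dichotomy pup abp az ba.
  case: (dis w); first exact/Af.
  by apply/Af/pf => /aut_inj.
have Ac x y t : orb (gen a b) z x -> orb (gen a b) z y -> x <= t -> t <= y ->
    orb (gen a b) z t by apply: orb_convex.
by have /(orbital_of_invariant pO Ac ((Af w).2 fw) inv) := (Af s).2 fs.
Qed.

Hypothesis invT : has_inverted G.
Hypothesis transT : aut_transitive T.

Lemma small_exists f x0 : one_orbital f x0 -> exists u v, small_for f u v.
Proof.
wlog fup : f / forall x, x <= f x => [W|].
  move=> fO; case: (one_orbital_direction fO) => fup; first exact: (W f).
  have [u [v uv]] := W _ fup (one_orbital_V fO).
  by exists u, v; apply: small_forV.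
move=> fO; have [x0f _] := fO.
have [fall|/existsNP[y fy]] := pselect (forall y, f y <> y).
  (* When [f] moves every point, any bump with a fixed point has smaller support; an orbital of an
     inverted [q] gives one, since [c x] lies outside it. *)
  have [c [q [/aut_moves[x qx] cq]]] := invT.
  have [p pO pP] := orbital_restrict qx.
  apply: (small_of_subbump (s := c x) fO pO) => //.
  by apply: pP.2; apply: inverter_leaves_orbital cq qx.
have {}fy := contrapT fy.
(* Transitivity yields a bump [f2] carrying a moved point of [f] to a fixed one, hence not commuting
   with [f]. If the resulting orbital of [gen a b] is the whole support of [f], the [a]-orbital of
   [z] is a smaller support inside, as it misses [b z]. *)
have [g gx] := transT x0 y.
have gx0 : g x0 <> x0 by rewrite gx => e; apply: x0f; rewrite -e.
have [f2 f2O f2P] := orbital_restrict gx0.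
have f2x : f2 x0 = y by rewrite f2P.1 //; apply: orb_refl (subg_cyc g) _.
have ff2 : (f * f2 <> f2 * f)%g.
  by move=> /esym/commuting_moved/(_ x0f); rewrite f2x.
have [a [b [/aut_moves[z az] [ba [abf _]]]]] := locT ff2.
have [//|Af] := small_case fO fup abf az ba.
have [p pO pP] := orbital_restrict az.
have bz : orb (gen a b) z (b z).
  by apply/(orb_actE (subg_gen a b)) => //; apply: orb_refl (subg_gen a b) z.
apply: (small_of_subbump (s := b z) fO pO).
- by move=> t /(agree_moved _ pP)[zt _]; apply/Af; apply: cyc_sub_gen.
- exact/Af.
- by apply: pP.2; apply: inverter_leaves_orbital ba az.
Qed.

Definition between x y v := (x <= v <= y) || (y <= v <= x).

Definition tied x y := forall h v, between x y v -> h v = v <-> h x = x.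

Lemma between_split x y z v : between x z v -> between x y v \/ between y z v.
Proof.
rewrite /between => /orP[] /andP[xv vz]; case: (leP v y) => vy.
- by left; rewrite xv.
- by right; rewrite vz ltW.
- by right; rewrite xv orbT.
- by left; rewrite vz (ltW vy) orbT.
Qed.

Lemma between_sym x y v : between x y v = between y x v.
Proof. by rewrite /between orbC. Qed.

Lemma between_r x y : between x y y.
Proof. by rewrite /between lexx; case: (leP x y) => //= /ltW->. Qed.

Lemma tied_sym x y : tied x y -> tied y x.
Proof.
move=> xy h v; rewrite between_sym => /(xy h) ->.
by symmetry; apply: xy; apply: between_r.
Qed.

Lemma tied_trans x y z : tied x y -> tied y z -> tied x z.
Proof.
move=> xy yz h v /(between_split y)[/xy//|/yz ->].
by apply: xy; apply: between_r.
Qed.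

Lemma tied_image g x y : tied x y -> tied (g x) (g y).
Proof.
move=> xy h v gv; have := xy (conjl g^-1 h) ((g^-1)%g v).
rewrite /between !aut_leV !aut_leVr => /(_ gv).
rewrite /conjl invgK !autM autVK => xyh; split=> [hv|hx].
  by apply: (@aut_inj _ _ (g^-1)%g); rewrite autK; apply/xyh; rewrite hv.
by apply: (@aut_inj _ _ (g^-1)%g); apply/xyh; rewrite hx autK.
Qed.

Lemma tied_convex x y z v : tied x y -> tied x z -> y <= v -> v <= z -> tied x v.
Proof.
move=> xy xz yv vz h w xw.
have [/xy//|/xz//] : between x y w \/ between x z w.
move: xw; rewrite /between => /orP[]/andP[xw wv]; [right|left].
  by rewrite xw (le_trans wv vz).
by rewrite wv (le_trans yv xw) orbT.
Qed.

(* The class of [x] for [tied] is a convex block on which every automorphism of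
   the block extends by the identity, yet no automorphism moves some points of
   the block and not others: [small_exists] would contradict this. *)
Lemma untied x y : x < y -> ~ tied x y.
Proof.
move=> xy txy; have [g gx] := transT x y.
have Fg w : tied x w <-> tied x (g w).
  split=> [/(@tied_image g)|]; first by rewrite gx; apply: tied_trans.
  move=> xgw; have := @tied_image (g^-1)%g _ _ (tied_trans (tied_sym txy) xgw).
  by rewrite -gx !autK.
have sat : saturated g (tied x).
  split=> // w v xw; have /Fg xgw := xw.
  by case/orP=> /andP[]; apply: tied_convex.
have [r rP] := restrict sat.
have xx : tied x x by move=> h v; rewrite /between orbb -eq_le => /eqP->.
have rx : r x <> x by rewrite rP.1 // gx => e; rewrite e ltxx in xy.
have [f fO fP] := orbital_restrict rx.
have [u [z [uO uf]]] := small_exists fO; have [uz _] := uO.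
have ufz := uf _ uz.
have fz : f z <> z by move=> e; apply: uz; move: ufz; rewrite e.
have rF w : r w <> w -> tied x w by move=> /(agree_moved _ rP)[].
have fF w : f w <> w -> tied x w by move=> /(agree_moved _ fP)[_ rw]; apply: rF rw.
have xfz : tied x (f z) by apply: fF => /aut_inj.
by apply: uz; apply/(fF _ fz u _ (between_r _ _))/(xfz u (f z) (between_r _ _)).
Qed.

(** Since [x] and [y] are not tied, some bump [f] moves a point and fixes another one between them,
    so a few consecutive [f]-steps from some [e] fit into the interval. A small [u] for [f] has
    convex support containing [z] but neither [f z] nor its preimage, and a power of [f] brings [z]
    to that place. *)
Lemma transitive_flexible : flexible T.
Proof.
move=> x y xy.
have [h [p [q [[xp py] [xq qy] hp hq]]]] : exists (h : G) (p q : T),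
    [/\ x <= p /\ p <= y, x <= q /\ q <= y, h p <> p & h q = q].
  have /existsNP[h /existsNP[v /not_implyP[xv]]] := untied xy.
  have {}xv : x <= v /\ v <= y.
    case/orP: xv => /andP[] // yv vx.
    by have := lt_le_trans xy (le_trans yv vx); rewrite ltxx.
  have xx : x <= x /\ x <= y by rewrite lexx ltW.
  have [hx|hx] := pselect (h x = x); have [hv|hv] := pselect (h v = v) => nt.
  - by case: nt.
  - by exists h, v, x.
  - by exists h, x, v.
  - by case: nt.
have [f [fO fq]] : exists f, one_orbital f p /\ f q = q.
  have [f fO fP] := orbital_restrict hp; exists f; split=> //.
  by apply: contrapT => /(agree_moved _ fP)[].
wlog fp : f fO fq / p < f p => [W|].
  case: (ltgtP p (f p)) => fp; [exact: (W f)| |by case: fO; rewrite -fp].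
  by apply: (W f^-1%g); [exact: one_orbital_V|exact: autV_fix|rewrite aut_ltVr].
have fqn n : zexpg f n q = q.
  by elim/int_step_ind: n => // n IH; rewrite (zexpgS, zexpgP) autM IH // autV_fix.
(* The fixed point [q] bounds the orbit of [p] on its side. The exponents 2 and -3 are the nearest
   to 0 for which both bounds are strict even if [p] is an end of the interval. *)
have [e [pe xe ey]] : exists e, [/\ orb (cyc f) p e, x < (f^-1)%g e & f (f e) < y].
  have fm (m n : int) : (m < n)%R -> zexpg f m p < zexpg f n p.
    by move=> mn; apply: (lt_le_trans (zexpg_up fp m)); apply: (zexpg_mono fp); lia.
  have pn n : orb (cyc f) p (zexpg f n p) by apply: orb_act; exists n.
  have fS (n : int) : f (zexpg f n p) = zexpg f (n + 1)%R p by rewrite zexpgS.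
  have fP (n : int) : (f^-1)%g (zexpg f n p) = zexpg f (n - 1)%R p by rewrite zexpgP.
  case: (ltgtP p q) => pq; last by case: hp; rewrite pq.
    exists (zexpg f 2%R p); rewrite !fS fP; split=> //.
      by apply: le_lt_trans xp (fm 0%R _ _).
    by apply: lt_le_trans qy; rewrite -(fqn (2 + 1 + 1)%R) aut_lt.
  exists (zexpg f (- 3%:Z)%R p); rewrite !fS fP; split=> //.
    by apply: le_lt_trans xq _; rewrite -(fqn (- 3%:Z - 1)%R) aut_lt.
  by apply: lt_le_trans py; apply: (fm _ 0%R); lia.
have [u [z [uO uf]]] := small_exists fO; have [uz _] := uO.
have fe := orb_cyc_up fp pe.
have ez : orb (cyc f) e z.
  apply: (orb_trans (subg_cyc f) (orb_sym (subg_cyc f) pe)).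
  by apply: fO.2 => fz; have := uf _ uz; rewrite fz.
have [n [en ne]] := orb_cyc_step fe ez.
have ufV w : u w <> w -> u ((f^-1)%g w) = (f^-1)%g w.
  by move=> uw; apply: contrapT => /uf; rewrite autVK.
exists (conjl (zexpg f (- n)%R) u); split=> [w|]; last first.
  by exists (zexpg f (- n)%R z); rewrite conjlE => /aut_inj.
move=> /conjl_moved; rewrite zexpgN invgK; set w' := zexpg f n w => uw.
have w'hi : w' < f z.
  rewrite ltNge; apply/negP => zw; apply: (one_orbital_convex uO uz uw _ zw).
    exact: ltW (orb_cyc_up fe ez).
  exact: uf.
have w'lo : (f^-1)%g z < w'.
  rewrite ltNge; apply/negP => zw; apply: (one_orbital_convex uO uw uz zw).
    by rewrite aut_leV ltW // (orb_cyc_up fe ez).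
  exact: ufV.
have fnC v : f (zexpg f n v) = zexpg f n (f v) by rewrite -!autM zexpg_commute.
have fnCV v : (f^-1)%g (zexpg f n v) = zexpg f n ((f^-1)%g v).
  by rewrite -!autM zexpg_commute // mulVg mulgV.
apply/andP; split.
  apply: (lt_trans xe); rewrite -(aut_lt (zexpg f n)) -fnCV.
  by apply: le_lt_trans w'lo; rewrite aut_le.
apply: lt_trans ey; rewrite -(aut_lt (zexpg f n)) -!fnC.
by apply: (lt_trans w'hi); rewrite aut_lt -autM -zexpgS.
Qed.

End LocallyMoving.

(** * Separability and completeness *)

Section Separability.
Variables (d : Order.disp_t) (T : orderType d).
Local Notation G := (order_aut T).
Implicit Types (c f g h k p r u w : G) (a b q x y z v s t : T).
Local Open Scope order_scope.

Definition no_endpoints := forall x, (exists y, y < x) /\ exists y, x < y.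

Definition dense_seq (D : nat -> T) := forall x y, x < y -> exists n, x < D n /\ D n < y.

Definition cut_complete := forall L : T -> Prop,
  (forall x y, L y -> x <= y -> L x) -> (exists x, L x) -> (exists x, ~ L x) ->
  (forall x, L x -> exists2 y, L y & x < y) -> exists s, forall x, L x <-> x < s.

Lemma transitive_no_endpoints : aut_transitive T -> has_inverted G -> no_endpoints.
Proof.
move=> trT [_ [f [/aut_moves[y fy] _]]] x; have [c <-] := trT y x.
case: (ltgtP y (f y)) => yf; last by case: fy.
  split; [exists (c ((f^-1)%g y))|exists (c (f y))]; by rewrite aut_lt // aut_ltV.
split; [exists (c (f y))|exists (c ((f^-1)%g y))]; by rewrite aut_lt // aut_ltVr.
Qed.

(* For two cuts [j] and [k] with a point between them, pick such a point. *)
Lemma dense_seq_of_cuts (J : countType) (C : J -> T -> Prop) (x0 : T) :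
  (forall j x y, C j y -> x <= y -> C j x) ->
  (forall x y, x < y -> exists j a b, [/\ x < a, b < y, C j a & ~ C j b]) ->
  (forall x y, x < y -> exists2 z, x < z & z < y) ->
  exists D, dense_seq D.
Proof.
move=> Cdown Csep dense.
have /choice[e eP] : forall jk : J * J, exists d : T, forall d', C jk.2 d' -> ~ C jk.1 d' ->
    C jk.2 d /\ ~ C jk.1 d.
  move=> jk; have [[d' [? ?]]|no] := pselect (exists d', C jk.2 d' /\ ~ C jk.1 d').
    by exists d'.
  by exists x0 => d' ? ?; case: no; exists d'.
exists (fun n => if unpickle n is Some jk then e jk else x0) => x y xy.
have [t xt ty] := dense _ _ xy.
have [j [a [b [xa bt Ca Cb]]]] := Csep _ _ xt.
have [k [a' [b' [ta by' Ca' Cb']]]] := Csep _ _ ty.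
have [||ek ej] := eP (j, k) t; first by apply: Cdown Ca' (ltW ta).
  by move=> Ct; apply: Cb; apply: Cdown Ct (ltW bt).
exists (pickle (j, k)); rewrite pickleK; split.
  apply: lt_trans xa _; rewrite ltNge; apply/negP => ea; apply: ej; exact: Cdown Ca ea.
apply: lt_trans by'; rewrite ltNge; apply/negP => be; apply: Cb'; exact: Cdown ek be.
Qed.

Hypothesis flexT : flexible T.
Hypothesis endT : no_endpoints.

(** By convexity the support of [g] would lie on one side of a fixed point; without endpoints there
    is room on the other side for an automorphism disjoint from [g]. *)
Lemma full_bump_moves g : full_bump g -> forall x, g x <> x.
Proof.
move=> [/(is_bumpP flexT)[x0 gO] gfull] x gx.
have [gx0 _] := gO.
suff [u [ug [z uz]]] : exists u : G, apart u g /\ exists z, u z <> z.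
  by apply: uz; rewrite (gfull u) //; apply/(disjP flexT).
case: (ltgtP x0 x) => xx; last by case: gx0; rewrite xx.
  have [_ [y xy]] := endT x; have [u [su uN]] := flexT xy; exists u; split=> // w.
  move=> /su/andP[xw _]; apply: contrapT => gw.
  by have := one_orbital_convex gO gx0 gw (ltW xx) (ltW xw).
have [[y yx] _] := endT x; have [u [su uN]] := flexT yx; exists u; split=> // w.
move=> /su/andP[_ wx]; apply: contrapT => gw.
by have := one_orbital_convex gO gw gx0 (ltW wx) (ltW xx).
Qed.

Lemma full_bump_orb g x y : full_bump g -> orb (cyc g) x y.
Proof.
move=> gF; have mv := full_bump_moves gF; have [/(is_bumpP flexT)[x0 [_ gO]] _] := gF.
exact: (orb_trans (subg_cyc g) (orb_sym (subg_cyc g) (gO _ (mv x))) (gO _ (mv y))).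
Qed.

(** The union [S] of the [h]-translates of one [w]-orbital is invariant under both. Cutting [w] down
    to [S] gives disjoint factors commuting with [h], so [S] must be the whole support. *)
Lemma orbit_of_orbitals h w q0 : (h * w = w * h)%g -> w q0 <> q0 ->
  (forall p r, w = (p * r)%g -> disj p r -> (p * h = h * p)%g -> (r * h = h * r)%g ->
    p = 1%g \/ r = 1%g) ->
  forall q, w q <> q -> exists n, orb (cyc w) (zexpg h n q0) q.
Proof.
move=> hw wq0 ind q wq; pose S y := exists n, orb (cyc w) (zexpg h n q0) y.
have sat : saturated w S.
  have s n := saturated_orb (zexpg h n q0) (subg_cyc w) (cyc_gen w).
  split=> [x|x y [n nx] xy]; last by exists n; apply: (s n).2 nx xy.
  by split=> -[n nx]; exists n; apply/((s n).1 x).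
have whw : conjl h w = w by rewrite /conjl hw mulgK.
have Sh y : S y <-> S (h y).
  have E n x : orb (cyc w) (h (zexpg h n q0)) (h x) <-> orb (cyc w) (zexpg h n q0) x.
    by rewrite -{1}whw orb_cyc_conj.
  split=> -[n ny]; first by exists (n + 1)%R; rewrite zexpgS; apply/E.
  by exists (n - 1)%R; apply/E; rewrite -autM -zexpgS subrK.
have [p pP] := restrict sat.
have pr : apart p (p^-1 * w)%g.
  by move=> y /(agree_moved _ pP)[Sy _]; rewrite autM -pP.1 // autK.
have ph : (p * h = h * p)%g.
  apply: order_aut_eq => y; rewrite !autM; have [Sy|Sy] := pselect (S y).
    by rewrite !pP.1 // -?Sh // -!autM hw.
  by rewrite !pP.2 // -Sh.
have [||||p1|r1] := ind p (p^-1 * w)%g; first by rewrite mulgA mulgV mul1g.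
- exact/(disjP flexT).
- exact: ph.
- apply: (mulgI p); rewrite !mulgA mulgV mul1g ph -(mulgA h p) mulgV mulg1.
  exact/esym.
- case: wq0; rewrite -pP.1 ?p1 //; exists 0%R; exact: orb_refl (subg_cyc w) _.
have wE : w = p by have := mulg1_eq r1; rewrite invgK.
by apply: contrapT => nq; apply: wq; rewrite wE; apply: pP.2.
Qed.

Lemma separated_dense_seq g : (forall x, x < g x) -> separated g -> T ->
  exists D, dense_seq D.
Proof.
move=> gup [h [w [hw [ind rig]]]] x0.
have [q0 wq0] : exists q0, w q0 <> q0.
  apply: contrapT => w1; have {}w1 : w = 1%g.
    by apply: order_aut_eq => y; apply: contrapT => wy; apply: w1; exists y.
  (* With [w] trivial the rigidity clause is vacuous for every element commuting with [g], in
     particular for [g] itself. *)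
  have g1 : g = 1%g.
    apply: rig => // p r wE /(disjP flexT) pr; apply/(disjP flexT) => t /conjl_moved pt.
    have := pr _ pt => rt; case: pt; rewrite -{2}[(g^-1)%g t]/((1%g : G) _) -w1 wE.
    by rewrite autM rt.
  by have := gup x0; rewrite g1 ltxx.
have orbs := orbit_of_orbitals hw wq0 ind.
pose M (i : int * int) z := orb (cyc w) (zexpg h i.2 q0) (zexpg g i.1 z).
have Mconv i x y z : M i x -> M i z -> x <= y -> y <= z -> M i y.
  by move=> Mx Mz xy yz; apply: orb_convex Mx Mz _ _; rewrite aut_le.
have Msep x y : x < y -> exists i a b, [/\ x < a < y, x < b < y, M i a & ~ M i b].
  move=> xy; pose v := Order.min y (g x).
  have [|u [su [z uz]]] := flexT (x := x) (y := v); first by rewrite lt_min xy gup.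
  have [|U [Ug UE Usupp]] := periodic_ext (u := u) (gup x).
    by move=> t /su; rewrite /v lt_min => /and3P[/ltW].
  have suv t : u t <> t -> (x < t < y) /\ (x < u t < y).
    move=> ut; have uut : u (u t) <> u t by move/aut_inj.
    by have := su _ ut; have := su _ uut; rewrite /v !lt_min => /and3P[-> -> _] /and3P[-> -> _].
  have U1 : U <> 1%g.
    apply: (@aut_neq1 _ _ _ z); rewrite UE //; have := su _ uz;
      by rewrite /v lt_min => /and3P[/ltW].
  have [p [r [wE pr nUp]]] : exists p r, [/\ w = (p * r)%g, apart p r & ~ apart (conjl U p) r].
    apply: contrapT => no; apply: U1; apply: rig => // p r wE /(disjP flexT) pr.
    by apply/(disjP flexT); apply: contrapT => n; apply: no; exists p, r.
  have [t [pt rt]] : exists t, conjl U p t <> t /\ r t <> t.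
    apply: contrapT => no; apply: nUp => t pt; apply: contrapT => rt.
    by apply: no; exists t.
  move: pt => /conjl_moved; move: rt; rewrite -{1 2}(autVK U t); set q := (U^-1)%g t => rt pq.
  have wq : w q <> q by rewrite wE autM pr.
  have [n nq] := orbs _ wq.
  have Uq : U q <> q by move=> e; apply: rt; rewrite e pr.
  have [m [xm mg um]] := Usupp _ Uq; have [mq umq] := suv _ um.
  have UmE : U (zexpg g m q) = zexpg g m (U q) by rewrite -!autM zexpg_commute.
  exists (- m, n)%R, (zexpg g m q), (U (zexpg g m q)); split=> //.
  - by rewrite UE.
  - by rewrite /M /= zexpgN autK.
  rewrite UmE /M /= zexpgN autK => nUq.
  apply: rt; apply: (pr); apply: (apart_orb wE pr pq).
  exact: (orb_trans (subg_cyc w) (orb_sym (subg_cyc w) nq) nUq).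
(* The two cuts at the ends of the translated orbital [M j.2]: with [true] all points up to its top,
   with [false] the points entirely below it. *)
pose C (j : bool * (int * int)) z := if j.1 then exists2 a, M j.2 a & z <= a
  else forall a, M j.2 a -> z < a.
apply: (dense_seq_of_cuts (C := C) x0) => [[[] i] x y /=|x y xy|x y].
- by move=> [a Ma ya] xy; exists a => //; apply: le_trans ya.
- by move=> H xy a /H; apply: le_lt_trans.
- have [i [a [b [/andP[xa ay] /andP[xb by_] Ma Mb]]]] := Msep _ _ xy.
  case: (ltgtP a b) => ab; last by case: Mb; rewrite -ab.
    exists (true, i), a, b; split=> //=; first by exists a.
    by move=> [a' Ma' ba']; apply: Mb; apply: Mconv Ma Ma' (ltW ab) ba'.
  exists (false, i), b, a; split=> //=; last by move/(_ _ Ma); rewrite ltxx.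
  move=> a' Ma'; rewrite ltNge; apply/negP => a'b; apply: Mb.
  exact: Mconv Ma' Ma a'b (ltW ab).
- by move=> /(flexible_dense flexT).
Qed.

End Separability.

Section Completeness.
Variables (d : Order.disp_t) (T : orderType d).
Local Notation G := (order_aut T).
Implicit Types (c f g h k p r u w : G) (a b q x y z v s t : T) (L : T -> Prop).
Local Open Scope order_scope.
Hypothesis flexT : flexible T.
Hypothesis endT : no_endpoints T.
Variable g : G.
Hypothesis gup : forall x, x < g x.
Hypothesis gorb : forall x y, orb (cyc g) x y.

Lemma below_power x y : exists n, y < zexpg g n x.
Proof.
have [_ [_ [_ [n ->] _ yn]]] := gorb x y; exists (n + 1)%R.
exact: le_lt_trans yn (zexpg_up (gup x) n).
Qed.

Lemma above_power x y : exists n, zexpg g n x < y.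
Proof.
have [_ [_ [[n ->] _ yn _]]] := gorb x y; exists (n - 1)%R.
by apply: lt_le_trans yn; have := zexpg_up (gup x) (n - 1)%R; rewrite subrK.
Qed.

Definition lower_bump f := [/\ exists x, one_orbital f x,
  forall x y, f y <> y -> x <= y -> f x <> x & exists y, f y = y].

(** The support of a half-line is stable under the inverse of [g], whose iterates go below every
    point, so convexity makes it a lower set. Conversely, along the [g]-orbit of [x] there is a last
    moved point, and the next one witnesses strictness. *)
Lemma half_line_lower f : half_line g f <-> lower_bump f.
Proof.
have nat_down (S : T -> Prop) : (forall z, S z -> S ((g^-1)%g z)) ->
    forall z (n : nat), S z -> S (zexpg g (- n%:Z)%R z).
  move=> Sg z n Sz; elim: n => [|n IH]; first by rewrite oppr0.
  by rewrite -addn1 PoszD opprD zexpgP; apply: Sg.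
split=> [hf|[[x fO] down [y fy]]].
  have [/(is_bumpP flexT)[x fO] _] := hf.
  have [inv [y [fy _]]] := (half_lineP flexT g fO).1 hf.
  split; [by exists x| |by exists y].
  move=> t z fz tz; have [n nt] := above_power z t.
  have [n0|n0] := leP 0%R n.
    have := le_lt_trans (zexpg_mono (gup z) n0) (lt_le_trans nt tz).
    by rewrite zexpg0 aut1 ltxx.
  have nE : n = (- (absz n)%:Z)%R by lia.
  apply: (one_orbital_convex fO _ fz (ltW nt) tz); rewrite nE.
  exact: (nat_down (fun z => f z <> z)).
apply/(half_lineP flexT g fO); split=> [z fz|].
  by apply: down fz _; rewrite aut_leV ltW.
have [m my] := below_power x y.
have fm : f (zexpg g m x) = zexpg g m x.
  by apply: contrapT => /down/(_ (ltW my)).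
have [n nx] := above_power x x.
have fn : f (zexpg g n x) <> zexpg g n x by apply: down (ltW nx); case: fO.
have le_nm : (n <= m)%R.
  rewrite leNgt; apply/negP => /ltW/(zexpg_mono (gup x)) mn; exact: down fn mn fm.
have [//|k [_ _ fk /contrapT fk1]] :=
  @int_first_failure (fun n => f (zexpg g n x) <> zexpg g n x) n m fn _ le_nm.
by exists (zexpg g (k + 1)%R x); split=> //; rewrite zexpgS autM autK.
Qed.

Definition upper_bump f := [/\ exists x, one_orbital f x,
  forall x y, f x <> x -> x <= y -> f y <> y & exists y, f y = y].

Lemma half_line_upper f : half_line (g^-1)%g f <-> upper_bump f.
Proof.
split=> [hf|[[x fO] up [y fy]]].
  have [/(is_bumpP flexT)[x fO] _] := hf.
  have [inv [y [fy _]]] := (half_lineP flexT (g^-1)%g fO).1 hf.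
  split; [by exists x| |by exists y].
  move=> z t fz zt; have [n nt] := below_power z t.
  have [n0|n0] := leP n 0%R.
    have := le_lt_trans zt (lt_le_trans nt (zexpg_mono (gup z) n0)).
    by rewrite zexpg0 aut1 ltxx.
  have nE : n = Posz (absz n) by lia.
  apply: (one_orbital_convex fO fz _ zt (ltW nt)); rewrite nE.
  elim: (absz n) => // m IH; rewrite -addn1 PoszD zexpgS.
  by have := inv _ IH; rewrite invgK.
apply/(half_lineP flexT (g^-1)%g fO); rewrite invgK; split=> [z fz|].
  by apply: up fz _; rewrite ltW.
have [n ny] := above_power x y.
have fn : f (zexpg g n x) = zexpg g n x.
  by apply: contrapT => /up/(_ (ltW ny)).
have [m mx] := below_power x x.
have fm : f (zexpg g m x) <> zexpg g m x by apply: up (ltW mx); case: fO.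
have le_nm : (n <= m)%R.
  rewrite leNgt; apply/negP => /ltW/(zexpg_mono (gup x)) mn; exact: up fm mn fn.
have [k [_ _ fk fk1]] :=
  @int_first_failure (fun n => f (zexpg g n x) = zexpg g n x) n m fn fm le_nm.
by exists (zexpg g k x); split=> //; move: fk1; rewrite zexpgS.
Qed.

Lemma lower_bump_conj c f : lower_bump f -> lower_bump (conjl c f).
Proof.
move=> [[x fO] down [y fy]]; split; first by exists (c x); apply: one_orbital_conj.
  move=> s t /conjl_moved ft st; apply/conjl_moved; apply: down ft _.
  by rewrite aut_le.
by exists (c y); rewrite conjlE fy.
Qed.

Lemma supp_le_lower f k : lower_bump f -> lower_bump k ->
  supp_le f k <-> forall z, f z <> z -> k z <> z.
Proof. by move=> [[x fO] _ _] [[y kO] _ _]; apply: (supp_leP flexT fO kO). Qed.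

Hypothesis faithG : faithful g.
Hypothesis homG : homogeneous g.

(** An automorphism [u] supported between [x] and [y] changes the support of some half-line by
    [faithful]; the end of that half-line must then lie where [u] acts. *)
Lemma lower_bump_between x y : x < y ->
  exists f, [/\ lower_bump f, f x <> x & f y = y].
Proof.
move=> /flexT[u [su [z uz]]].
have /faithG[f [/half_line_lower fL nf]] : u <> 1%g by apply: aut_neq1 uz.
have ufL := lower_bump_conj u fL.
have [v [xv vy nv]] : exists v, [/\ x < (u^-1)%g v < y, x < v < y
    & ~ (f v <> v <-> f ((u^-1)%g v) <> (u^-1)%g v)].
  apply: contrapT => no; apply: nf; have E v : f v <> v <-> f ((u^-1)%g v) <> (u^-1)%g v.
    have [uv|uv] := pselect (u v = v); first by rewrite (autV_fix uv).
    apply: contrapT => nv; apply: no; exists v; split=> //; apply: su => //.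
    by move=> e; apply: uv; move: e; rewrite autVK => {1}->; rewrite autVK.
  rewrite !supp_le_lower //; split=> v fv; first exact/conjl_moved/(E v).1.
  exact/(E v).2/conjl_moved.
have [_ down _] := fL; exists f; move: xv vy => /andP[xv vy] /andP[xv' vy'].
have [fv|fv] := pselect (f v = v).
  have fu : f ((u^-1)%g v) <> (u^-1)%g v by move=> fu; apply: nv; rewrite fv fu.
  split=> //; first by apply: down fu (ltW xv).
  by apply: contrapT => fy; case: (down _ _ fy (ltW vy')).
have fu : f ((u^-1)%g v) = (u^-1)%g v by apply: contrapT => fu; apply: nv.
split=> //; first by apply: down fv (ltW xv').
by apply: contrapT => fy; case: (down _ _ fy (ltW vy)).
Qed.

Lemma lower_bump_2homogeneous f1 f2 k1 k2 x y :
  lower_bump f1 -> lower_bump f2 -> f1 x = x -> f2 x <> x ->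
  lower_bump k1 -> lower_bump k2 -> k1 y = y -> k2 y <> y ->
  exists c, (forall z, f1 z <> z <-> k1 (c z) <> c z) /\
            (forall z, f2 z <> z <-> k2 (c z) <> c z).
Proof.
move=> f1L f2L f1x f2x k1L k2L k1y k2y.
have lt_lower p r z : lower_bump p -> lower_bump r -> p z = z -> r z <> z ->
    supp_le p r /\ ~ supp_le r p.
  move=> pL rL pz rz; rewrite !supp_le_lower //; split=> [w pw|/(_ _ rz)//].
  have [_ pdown _] := pL; have [_ rdown _] := rL.
  by apply: rdown rz _; rewrite leNgt; apply/negP => /ltW/(pdown _ _ pw).
have [f12 f21] := lt_lower _ _ _ f1L f2L f1x f2x.
have [k12 k21] := lt_lower _ _ _ k1L k2L k1y k2y.
have half p (pL : lower_bump p) : half_line g p := (half_line_lower p).2 pL.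
have [c] := homG (half _ f1L) (half _ f2L) f12 f21 (half _ k1L) (half _ k2L) k12 k21.
rewrite !supp_le_lower //; try exact: lower_bump_conj.
move=> [fk1 [kf1 [fk2 kf2]]]; exists c; split=> z.
  by split=> [H|/kf1/conjl_moved]; rewrite ?autK //; apply: fk1; rewrite conjlE => /aut_inj.
by split=> [H|/kf2/conjl_moved]; rewrite ?autK //; apply: fk2; rewrite conjlE => /aut_inj.
Qed.

(* The bump is glued from automorphisms carrying the piece between consecutive
   half-line ends near [x n] and [x (n + 1)] to the next piece. *)
Lemma lower_bump_at L (x : int -> T) : (forall a b, L b -> a <= b -> L a) ->
  (exists t, ~ L t) -> (forall n, x n < x (n + 1)%R) -> (forall n, L (x n)) ->
  (forall z, L z -> exists n, z < x n) -> (forall z, exists n, x n < z) ->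
  exists2 f, lower_bump f & forall z, L z <-> f z <> z.
Proof.
move=> Ldown [t Lt] xinc Lx xcof xcoi.
have /choice[k kP] : forall n : int, exists k : G,
    [/\ lower_bump k, k (x n) <> x n & k (x (n + 1)%R) = x (n + 1)%R].
  by move=> n; apply: lower_bump_between.
have kL n : lower_bump (k n) by case: (kP n).
have kdown n a b : k n b <> b -> a <= b -> k n a <> a by case: (kL n) => _ + _; apply.
have kx n : k n (x n) <> x n by case: (kP n).
have kx1 n : k n (x (n + 1)%R) = x (n + 1)%R by case: (kP n).
(* [c n] has to carry both ends of a tile at once: this is why [homogeneous] is about pairs of
   half-lines. *)
have /choice[c cP] : forall n : int, exists c : G,
    (forall z, k n z <> z <-> k (n + 1)%R (c z) <> c z) /\
    (forall z, k (n + 1)%R z <> z <-> k (n + 1 + 1)%R (c z) <> c z).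
  by move=> n; apply: (lower_bump_2homogeneous (x := x (n + 1)%R) (y := x (n + 1 + 1)%R)).
pose S (n : int) z := k n z <> z; pose S' (n : int) z := S (n + 1)%R z.
have k_lt n z : S n z -> z < x (n + 1)%R.
  by move=> Sz; rewrite ltNge; apply/negP => /(kdown _ _ _ Sz); rewrite kx1.
have chS : chain S.
  split=> [n a b|n z Sz]; first exact: kdown.
  by apply: kdown (kx _) _; apply/ltW/k_lt.
have shift P : (forall n : int, P (n + 1)%R) -> forall n : int, P n.
  by move=> H n; rewrite -(subrK 1%R n).
have tS : tiling S S' c.
  split=> //; try by move=> n; first [exact: (cP n).1|exact: (cP n).2].
  - by split=> [n a b Sb ab|n z Sz]; [exact: (chain_down chS Sb ab)|exact: (chain_step chS Sz)].
  - by move=> z; split=> H; [move=> n; exact: (H (n + 1)%R)|apply: shift => n; exact: (H n)].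
  - by move=> z; split=> H; [move=> n; exact: (H (n + 1)%R)|apply: shift => n; exact: (H n)].
have [F FP] := tile_aut tS.
have FS n z : S n z <-> S (n + 1)%R (F z) := tiling_piecewise n z tS FP.
have LS z : L z <-> exists n, S n z.
  split=> [/xcof[n zn]|[n /k_lt zn]]; first by exists n; apply: kdown (kx n) (ltW zn).
  by apply: Ldown (Lx _) (ltW zn).
have nS z : exists n, ~ S n z.
  have [n nz] := xcoi z; exists (n - 1)%R => /k_lt; rewrite subrK => /(lt_trans nz).
  by rewrite ltxx.
have Fz z : L z <-> F z <> z.
  split=> [/LS[m Sm]|Fz].
    case: (tileP z chS) => [[n [Sn1 Sn]] e|[|/(_ m)//]]; last by have [n nz] := nS z => /(_ n).
    by apply: Sn; apply/FS; rewrite e.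
  apply: contrapT => nL; apply: Fz; apply: FP.2; right=> n Sn; apply: nL.
  by apply/LS; exists n.
have FSn (m : nat) n z : S n z <-> S (n + m%:Z)%R (zexpg F m z).
  elim: m => [|m IH]; first by rewrite addr0.
  by rewrite -addn1 PoszD addrA zexpgS autM -FS.
exists F => //; split.
- exists (x 0%R); split=> [|y /Fz/LS[m Sm]]; first exact/Fz.
  (* [F] shifts the cuts [S n] by one, [x 0] lies in [S 0] and not in [S (-1)], and [y] lies in
     [S m] and not in [S j]; these exponents therefore bring [x 0] below and above [y]. *)
  have [j Sj] := nS y.
  exists (zexpg F (- (absz j)%:Z)%R), (zexpg F (absz m).+1); split.
  + by exists (- (absz j)%:Z)%R.
  + by exists (absz m).+1.
  + rewrite leNgt; apply/negP => ylt; apply: Sj.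
    have : S (- (absz j)%:Z)%R (zexpg F (- (absz j)%:Z)%R (x 0%R)).
      by rewrite (FSn (absz j)) addNr -autM -zexpgD subrr; apply: kx.
    move=> /kdown /(_ (ltW ylt)); apply: (chain_mono chS); lia.
  + rewrite leNgt; apply/negP => ylt.
    have S1 : ~ S (- 1)%R (x 0%R) by move=> /k_lt; rewrite addNr ltxx.
    apply: S1; apply/(FSn (absz m).+1); apply: (kdown _ _ y); last exact: ltW.
    by apply: chain_mono chS _ Sm; lia.
- by move=> a b /Fz Lb ab; apply/Fz; apply: Ldown ab.
- by exists t; apply: contrapT => /Fz.
Qed.

Variable D : nat -> T.
Hypothesis denseD : dense_seq D.

Lemma lower_set_bump L : (forall a b, L b -> a <= b -> L a) -> (exists x, L x) ->
  (exists t, ~ L t) -> (forall a, L a -> exists2 b, L b & a < b) ->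
  exists2 f, lower_bump f & forall z, L z <-> f z <> z.
Proof.
move=> Ldown [l0 Ll0] Lt Lmax.
have /choice[nxt nxtP] : forall z, exists z', L z -> L z' /\ z < z'.
  move=> z; have [/Lmax[z' Lz' zz']|nL] := pselect (L z); first by exists z'.
  by exists z.
(* At stage [m] the new term passes the old one and also [D m] if that lies in [L], so density of
   [D] makes the sequence cofinal in [L]. Downwards, the powers of [g] applied to [l0] are
   coinitial. *)
pose y := fix y n := if n is m.+1 then
  nxt (if pselect (L (D m)) is left _ then Order.max (y m) (D m) else y m) else l0.
have Ly n : L (y n).
  elim: n => //= n IH; apply: (nxtP _ _).1; case: pselect => // LD.
  by rewrite maxEle; case: ifP.
have yD m : y m < y m.+1 /\ (L (D m) -> D m < y m.+1).
  rewrite /=; case: pselect => LD; last by split=> //; apply: (nxtP _ _).2.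
  have /nxtP[_] : L (Order.max (y m) (D m)) by rewrite maxEle; case: ifP => // _; apply: Ly.
  by rewrite gt_max => /andP[].
pose x (n : int) := match n with Posz m => y m | Negz m => zexpg g (Negz m) l0 end.
have xneg n : (n <= 0)%R -> x n = zexpg g n l0 by case: n => // -[|n].
apply: (lower_bump_at (x := x)) => //.
- move=> [n|n]; first by rewrite -PoszD addn1; case: (yD n).
  rewrite (xneg (Negz n + 1)%R); last by lia.
  by rewrite (xneg (Negz n)) //; apply: zexpg_up.
- move=> [n|n]; first exact: Ly.
  apply: Ldown Ll0 _; have : (Negz n <= 0)%R by [].
  by move=> /(zexpg_mono (gup l0)).
- move=> z /Lmax[z' Lz' zz']; have [n [zn nz']] := denseD zz'.
  exists n.+1; apply: lt_trans zn _; apply: (yD n).2.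
  exact: Ldown Lz' (ltW nz').
- move=> z; have [n nz] := above_power l0 z.
  exists (Num.min n 0)%R; rewrite xneg; last by lia.
  by apply: le_lt_trans nz; apply: zexpg_mono => //; lia.
Qed.

Lemma homogeneous_complete : cut_complete T.
Proof.
move=> L Ldown L0 Lt Lmax; have [f fL fP] := lower_set_bump Ldown L0 Lt Lmax.
have [t0 _] := L0.
have [|||t tt0|k kL kP] := @lower_set_bump (fun z => z < t0).
- by move=> a b bt ab; apply: le_lt_trans bt.
- by case: (endT t0).
- by exists t0; rewrite ltxx.
- by have [z tz zt] := flexible_dense flexT tt0; exists z.
(* Homogeneity compares pairs, so each half-line is completed by its [g]-translate, which is
   strictly larger. *)
have up p : lower_bump p -> exists z, p z = z /\ conjl g p z <> z.
  move=> pL; have [[x pO] _ _] := pL.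
  have [_ [z [pz pgz]]] := (half_lineP flexT g pO).1 ((half_line_lower p).2 pL).
  by exists z; split=> //; apply/conjl_moved.
have [x [fx gfx]] := up f fL; have [y [ky gky]] := up k kL.
have [c [cf _]] := lower_bump_2homogeneous fL (lower_bump_conj g fL) fx gfx
  kL (lower_bump_conj g kL) ky gky.
by exists ((c^-1)%g t0) => z; rewrite fP cf -kP aut_ltVr.
Qed.

End Completeness.

(** * The real line *)

Section FlexibleGroups.
Variables (d : Order.disp_t) (T : orderType d).
Local Notation G := (order_aut T).
Implicit Types (a b f g h k u : G) (x y z : T).
Local Open Scope order_scope.
Hypothesis flexT : flexible T.

Lemma flexible_has_inverted x y : x < y -> has_inverted G.
Proof.
move=> /(flexible_klein flexT)[a [b [_ _ [z az] ba]]].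
by exists b, a; split=> //; apply: aut_neq1 az.
Qed.

(** Noncommuting [f] and [g] both move some point. Anything supported in a common wandering interval
    there commutes with the [f]- and [g]-conjugates of anything else supported there, so a Klein
    pair in it will do. *)
Lemma flexible_locally_moving : locally_moving G.
Proof.
move=> f g fg; have [x [fx gx]] : exists x, f x <> x /\ g x <> x.
  apply: contrapT => no; apply: fg; apply: apart_commute => x fx.
  by apply: contrapT => gx; apply: no; exists x.
have [v1 [xv1 V1]] := wandering fx; have [v2 [xv2 V2]] := wandering gx.
pose v := Order.min v1 v2.
have [|a [b [sa sb [z az] ba]]] := flexible_klein flexT (x := x) (y := v).
  by rewrite lt_min xv1.
have free (h : G) (w : T) : v <= w ->
    (forall (n : int) z, x < z < w -> x < zexpg h n z < w -> n = 0%R) ->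
    forall k l, supp_in k x v -> supp_in l x v -> (k * conjl h l = conjl h l * k)%g.
  move=> vw hV k l sk sl; apply: apart_commute => t /sk/andP[xt tv].
  apply: contrapT => /conjl_moved/sl/andP[xt' tv'].
  have := hV 1%R ((h^-1)%g t); rewrite zexpg1 autVK xt xt' !(lt_le_trans _ vw) //.
  by move=> /(_ isT isT).
have free_f := free f v1 _ V1; have free_g := free g v2 _ V2.
have vv1 : v <= v1 by rewrite ge_min lexx. have vv2 : v <= v2 by rewrite ge_min lexx orbT.
exists a, b; split; first exact: aut_neq1 az.
by split=> //; split; do !split; (apply: free_f || apply: free_g).
Qed.

End FlexibleGroups.

Section RealLine.
Variable R : realType.
Local Notation G := (order_aut R).
Implicit Types (f g h k p r u w : G) (x y z s t q c m n : R).
Local Open Scope ring_scope.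

Lemma real_lub (E : R -> Prop) b0 : (exists x, E x) -> (forall x, E x -> x <= b0) ->
  exists s, (forall x, E x -> x <= s) /\ forall b, (forall x, E x -> x <= b) -> s <= b.
Proof.
move=> E0 Eb; exists (sup E); split=> [x Ex|b Eb'].
  by apply: sup_upper_bound Ex; split=> //; exists b0.
by apply: ge_sup.
Qed.

Lemma translation_ex (e : R) : exists f : G, forall x, f x = x + e.
Proof.
have [|||f fE] := @build_aut _ R (fun x => x + e) (fun x => x - e).
- by move=> x; rewrite addrK.
- by move=> x; rewrite subrK.
- by move=> x y xy; rewrite lerD2r.
by exists f => x; rewrite fE.
Qed.

Definition kink_fun (c m n x : R) := if x <= c then c + m * (x - c) else c + n * (x - c).

Lemma kink_funK c m n : 0 < m -> 0 < n ->
  cancel (kink_fun c m n) (kink_fun c m^-1 n^-1).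
Proof.
move=> m0 n0 x; rewrite /kink_fun; case: (leP x c) => xc.
  have le : c + m * (x - c) <= c by rewrite gerDl pmulr_rle0 // subr_le0.
  by rewrite le; field; rewrite gt_eqF.
have gt : c < c + n * (x - c) by rewrite ltrDl mulr_gt0 // subr_gt0.
by rewrite leNgt gt /=; field; rewrite gt_eqF.
Qed.

Lemma kink_ex (c m n : R) : 0 < m -> 0 < n -> exists f : G,
  (forall x, x <= c -> f x = c + m * (x - c)) /\
  (forall x, c <= x -> f x = c + n * (x - c)).
Proof.
move=> m0 n0.
have kL x : x <= c -> kink_fun c m n x = c + m * (x - c) by rewrite /kink_fun => ->.
have kR x : c <= x -> kink_fun c m n x = c + n * (x - c).
  rewrite le_eqVlt => /orP[/eqP<-|cx]; first by rewrite kL // subrr !mulr0.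
  by rewrite /kink_fun leNgt cx.
have [|||f fE] := @build_aut _ R (kink_fun c m n) (kink_fun c m^-1 n^-1).
- exact: kink_funK.
- by have := @kink_funK c m^-1 n^-1; rewrite !invrK; apply; rewrite invr_gt0.
- move=> x y xy; have [yc|cy] := leP y c.
    by rewrite !kL ?(le_trans xy) // lerD2l ler_pM2l // lerD2r.
  rewrite (kR y) ?(ltW cy) //; have [xc|cx] := leP x c; last first.
    by rewrite kR ?(ltW cx) // lerD2l ler_pM2l // lerD2r.
  rewrite kL // lerD2l; apply: (@le_trans _ _ 0).
    by rewrite pmulr_rle0 // subr_le0.
  by rewrite pmulr_rge0 // subr_ge0 ltW.
- by exists f; split=> x xc; rewrite fE; [apply: kL|apply: kR].
Qed.

Lemma real_bump x y : x < y -> exists u : G,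
  (forall z, u z <> z -> x < z < y) /\ (forall z, x < z < y -> z < u z).
Proof.
move=> xy.
(* The composite has slopes 1, 2, 1/2, 1 with breaks at [x], [x + (y - x) / 3] and [y]; the kink of
   [b] sits at the image of the middle break under [a]. *)
have [||a [aL aR]] := @kink_ex x 1 2; try lra.
have [||b [bL bR]] := @kink_ex ((x + y * 2) / 3) 1 (1 / 4); try lra.
have [||c [cL cR]] := @kink_ex y 1 2; try lra.
exists (c * b * a)%g; split=> [z|z /andP[xz zy]]; rewrite -!mulgA !autM; last first.
  rewrite aR; last lra.
  have [zm|zm] := leP (x + 2 * (z - x)) ((x + y * 2) / 3).
    by rewrite bL // cL; lra.
  by rewrite bR ?(ltW zm) // cL; lra.
move=> H; apply/andP; split; rewrite ltNge; apply/negP => zz; apply: H.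
  rewrite aL // bL; last lra.
  by rewrite cL; lra.
rewrite aR; last lra.
rewrite bR; last lra.
by rewrite cR; lra.
Qed.

Lemma real_flexible : flexible R.
Proof.
move=> x y xy; have [u [su uz]] := real_bump xy; exists u; split=> //.
exists ((x + y) / 2); have := uz ((x + y) / 2); lra.
Qed.

(** If the iterates of [x] stayed below [y], their supremum [s] would be at most its own preimage
    under [f], contrary to [s < f s]. *)
Lemma real_orb f x y : x <= y -> (forall z, x <= z -> z <= y -> z < f z) ->
  orb (cyc f) x y.
Proof.
move=> xy fup; apply: contrapT => nxy.
have below (n : nat) : zexpg f n x < y.
  rewrite ltNge; apply/negP => yn; apply: nxy; exists 1%g, (zexpg f n).
  by split=> //; [exists 0|exists n].
have [|x0 [n ->]|s [sub slub]] := @real_lub (fun z => exists n : nat, z = zexpg f n x) y.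
- by exists x, 0%N.
- exact: ltW.
have xs : x <= s by apply: sub; exists 0%N.
have sy : s <= y by apply: slub => _ [n ->]; apply: ltW.
have := fup s xs sy; rewrite -aut_ltV ltNge => /negP; apply.
apply: slub => _ [n ->]; rewrite aut_leVr; apply: sub; exists n.+1.
by rewrite -addn1 PoszD zexpgS.
Qed.

Lemma real_one_orbital f x0 : x0 < f x0 ->
  (forall y z, f y <> y -> between x0 y z -> z < f z) -> one_orbital f x0.
Proof.
move=> fx0 fup; split=> [|y fy]; first by apply/eqP; rewrite gt_eqF.
case: (leP x0 y) => xy.
  by apply: real_orb => // z xz zy; apply: (fup y) => //; rewrite /between xz zy.
apply: orb_sym; first exact: subg_cyc.
by apply: real_orb (ltW xy) _ => z xz zy; apply: (fup y) => //; rewrite /between xz zy orbT.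
Qed.

Lemma nat_above x : exists n : nat, x < n%:R.
Proof.
exists (Num.bound `|x|); apply: le_lt_trans (ler_norm x) _.
exact: archi_boundP.
Qed.

(* [x |-> x + 1] for [x <= 0] and [x |-> 2 x + 1] for [0 <= x]: iterates eventually
   expand any interval beyond length 1, so the preimages of the integers under
   its powers are dense. *)
Lemma expanding_map : exists g : G, (forall x, x + 1 <= g x) /\
  forall s t, 0 <= s -> s <= t -> g t - g s = 2 * (t - s).
Proof.
have [||k [kL kR]] := @kink_ex 0 1 2; try lra.
have [e eE] := translation_ex 1; exists (e * k)%g; split=> [x|s t s0 st].
  rewrite autM eE; have [x0|x0] := leP x 0; [rewrite kL|rewrite kR]; lra.
by rewrite !autM !eE !kR; lra.
Qed.

Lemma expanding_meets_int g a b : (forall x, x + 1 <= g x) ->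
  (forall s t, 0 <= s -> s <= t -> g t - g s = 2 * (t - s)) -> a < b ->
  exists (m : nat) (n : int), zexpg g m a < n%:~R < zexpg g m b.
Proof.
move=> g1 g2 ab.
have ga (m : nat) x : x + m%:R <= zexpg g m x.
  elim: m => [|m IH]; first by rewrite addr0.
  rewrite -addn1 PoszD zexpgS autM natrD addrA.
  by apply: le_trans (g1 _); rewrite lerD2r.
have [m0 m0a] := nat_above (- a).
pose s := zexpg g m0 a; pose t := zexpg g m0 b.
have s0 : 0 <= s by apply: le_trans (ga m0 a); lra.
have st : s < t by rewrite aut_lt.
(* The length doubles at each step; the linear bound suffices and follows from
   [k + 2 <= 2 * (k + 1)]. *)
have grow (k : nat) : 0 <= zexpg g k s /\ k.+1%:R * (t - s) <= zexpg g k t - zexpg g k s.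
  elim: k => [|k [IH0 IH]]; first by rewrite mul1r.
  rewrite -[k.+1]addn1 PoszD zexpgS !autM; split.
    by apply: le_trans (g1 _); lra.
  rewrite g2 //; last by rewrite aut_le ltW.
  apply: le_trans (_ : 2 * (k.+1%:R * (t - s)) <= _); last by rewrite ler_pM2l.
  rewrite mulrA ler_pM2r ?subr_gt0 // -natrM ler_nat; lia.
have [k kP] := nat_above (t - s)^-1.
have [sk tk] := grow k.
have gap : 1 < zexpg g k t - zexpg g k s.
  apply: lt_le_trans tk; rewrite -[X in X < _](mulVf (x := t - s)); last by rewrite subr_eq0 gt_eqF.
  rewrite ltr_pM2r ?subr_gt0 //; apply: lt_trans kP _.
  by rewrite ltr_nat.
exists (k + m0)%N, (Num.floor (zexpg g k s) + 1).
rewrite PoszD zexpgD !autM floorD1_gt /=.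
have := floor_le (zexpg g k s); rewrite intrD; lra.
Qed.

(** [h] is the unit translation and [w] a periodic bump with orbitals the intervals between
    consecutive integers. A [v] preserving these fixes the integers; if it also commutes with [g],
    it fixes their preimages under powers of [g], which are dense. *)
Lemma real_separated g : (forall x, x + 1 <= g x) ->
  (forall s t, 0 <= s -> s <= t -> g t - g s = 2 * (t - s)) -> separated g.
Proof.
move=> g1 g2; have [h hE] := translation_ex 1.
have [|u [su uup]] := @real_bump 0 1; first lra.
have hn (n : int) x : zexpg h n x = x + n%:~R.
  elim/int_step_ind: n => [|n IH|n IH]; first by rewrite addr0.
    by rewrite zexpgS autM IH hE intrD; lra.
  by rewrite zexpgP autM IH intrB; apply: (@aut_inj _ _ h); rewrite autVK hE; lra.
have [||w [wh wu wsupp]] := @periodic_ext _ R h u 0.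
- by rewrite hE; lra.
- by move=> z /su; rewrite hE; lra.
have hw : (h * w = w * h)%g by [].
have w_int (n : int) : w n%:~R = n%:~R.
  apply: contrapT => /wsupp[m [_ _ /su]]; rewrite hn -intrD.
  by rewrite -[X in X < _ < _]/((0%Z)%:~R) -[X in _ < _ < X]/((1%Z)%:~R) !ltr_int; lia.
have w_up (z : R) : 0 < z < 1 -> z < w z.
  by move=> z01; rewrite wu ?hE //; [exact: uup|lra|lra].
have w_shift (n : int) z : w z <> z <-> w (zexpg h n z) <> zexpg h n z.
  have hnw : (zexpg h n * w = w * zexpg h n)%g by apply/esym/zexpg_commute.
  by rewrite -!autM -hnw !autM; split=> [H /aut_inj //|H e]; rewrite e in H.
have w_moved z : w z <> z -> exists n : int, 0 < zexpg h n z < 1.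
  by move=> /wsupp[n [_ _ /su]]; exists n.
have w_nonint z (n : int) : n%:~R < z < n%:~R + 1 -> w z <> z.
  move=> nz; apply/(w_shift (- n)); have : 0 < zexpg h (- n) z < 1.
    by rewrite hn intrN; lra.
  by move=> /w_up; rewrite lt_def => /andP[/eqP].
pose q0 : R := 1 / 2.
have q01 : 0 < q0 < 1 by rewrite /q0; lra.
have wq0 : w q0 <> q0 by have := w_up _ q01; rewrite lt_def => /andP[/eqP].
exists h, w; split=> //; split=> [p r wE /(disjP real_flexible) pr ph rh|v vg vw].
  wlog pq0 : p r wE pr ph rh / p q0 <> q0 => [W|].
    have [pq|] := pselect (p q0 = q0); last exact: (W p r).
    have [|||||->|->] := W r p; [| | | | |by right|by left] => //.
    - by rewrite wE; apply: apart_commute.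
    - exact: apart_sym.
    - by move=> rq; apply: wq0; rewrite wE autM rq pq.
  right; apply: contrapT => /aut_moves[t rt].
  have wt : w t <> t by rewrite wE autM (apart_sym pr) // => /aut_inj.
  have [n nt] := w_moved _ wt.
  have rn : r (zexpg h n t) <> zexpg h n t.
    apply: commuting_moved rt; apply/esym/zexpg_commute; exact: rh.
  apply: rn; apply: (pr); apply: (apart_orb wE pr pq0).
  have [le_qt|lt_tq] := leP q0 (zexpg h n t).
    by apply: real_orb => // z qz zt; apply: w_up; lra.
  apply: orb_sym; first exact: subg_cyc.
  by apply: real_orb => [|z qz zt]; [exact: ltW|apply: w_up; lra].
(* Split off from [w] its orbital through [q]. If [v q] were in another orbital, it would be moved
   both by the [v]-conjugate of the first factor and by the second. *)
have no_cross q (n : int) : w q <> q -> w (v q) <> v q ->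
    q < n%:~R < v q \/ v q < n%:~R < q -> False.
  move=> wq wvq cross; have [p pO pP] := orbital_restrict wq.
  have qq := orb_refl (subg_cyc w) q.
  have nvq : ~ orb (cyc w) q (v q).
    move=> qv; have : orb (cyc w) q n%:~R.
      case: cross => /andP[/ltW l1 /ltW l2]; first exact: orb_convex qq qv l1 l2.
      exact: orb_convex qv qq l1 l2.
    by move=> /(orb_cyc_moved wq); apply; apply: w_int.
  have pr : apart p (p^-1 * w)%g.
    by move=> z /(agree_moved _ pP)[Sz _]; rewrite autM -pP.1 // autK.
  have /(disjP real_flexible) :=
    vw p (p^-1 * w)%g (esym (mulVKg _ _)) ((disjP real_flexible _ _).2 pr).
  move=> /(_ (v q)); rewrite conjlE => E; apply: wvq.
  have /E : v (p q) <> v q by move/aut_inj; case: pO.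
  rewrite autM => e; have := pP.2 _ nvq; rewrite -{1}e autVK => ->; exact.
have nonint (a b : R) : a < b -> exists y, a < y < b /\ w y <> y.
  move=> ab; have /andP[fa af] := floor_itv a; pose e := Num.min b (Num.floor a + 1)%:~R.
  have [ae eb ef] : [/\ a < e, e <= b & e <= (Num.floor a + 1)%:~R].
    by rewrite /e lt_min ab af !ge_min !lexx orbT.
  exists ((a + e) / 2); split; first lra.
  by apply: (w_nonint _ (Num.floor a)); move: ef; rewrite intrD; lra.
(* If [v] displaces [n], a non-integer close to [v n], between it and [n], has a non-integer
   preimage on the other side of [n], against [no_cross]. *)
have v_int (n : int) : v n%:~R = n%:~R.
  have unit_interval z (k : int) : k%:~R < z -> z < k%:~R + 1 -> w z <> z.
    by move=> kz zk; apply: (w_nonint _ k); rewrite kz.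
  case: (ltgtP (v n%:~R) (n%:~R : R)) => // vn; exfalso.
    have [|y [/andP[ly hy] wy]] := nonint (v n%:~R) (Num.min n%:~R (v (n%:~R + 1))).
      by rewrite lt_min vn aut_lt; lra.
    move: hy; rewrite lt_min => /andP[yn yv].
    have qn : n%:~R < (v^-1)%g y by rewrite aut_ltVr.
    apply: (no_cross ((v^-1)%g y) n); rewrite ?autVK //; last by right; rewrite yn.
    by apply: (unit_interval _ n) => //; rewrite aut_ltV.
  have [|y [/andP[ly hy] wy]] := nonint (Num.max n%:~R (v (n%:~R - 1))) (v n%:~R).
    by rewrite gt_max vn aut_lt; lra.
  move: ly; rewrite gt_max => /andP[yn yv].
  have qn : (v^-1)%g y < n%:~R by rewrite aut_ltV.
  apply: (no_cross ((v^-1)%g y) n); rewrite ?autVK //; last by left; rewrite qn.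
  apply: (unit_interval _ (n - 1)); first by rewrite intrB aut_ltVr.
  by rewrite intrB subrK.
apply: contrapT => /aut_moves[x vx].
have vgm (m : nat) z : v (zexpg g m z) = zexpg g m (v z).
  by rewrite -!autM zexpg_commute.
case: (ltgtP x (v x)) => xv; last by case: vx.
  have [m [k /andP[xk kv]]] := expanding_meets_int g1 g2 xv.
  by move: xk; rewrite -(aut_lt v) v_int vgm => /(lt_trans kv); rewrite ltxx.
have [m [k /andP[xk kv]]] := expanding_meets_int g1 g2 xv.
by move: kv; rewrite -(aut_lt v) v_int vgm => /(lt_trans xk); rewrite ltxx.
Qed.

Lemma supp_le_incl f k : (forall z, f z <> z -> k z <> z) -> supp_le f k.
Proof.
move=> fk; apply/(supp_le_apart real_flexible) => h hk w hw.
by apply: contrapT => /fk/(apart_sym hk).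
Qed.

Lemma increasing_two_points (s1 s2 t1 t2 : R) :
  (s1 < s2 /\ t1 < t2) \/ (s2 < s1 /\ t2 < t1) -> exists c : G, c s1 = t1 /\ c s2 = t2.
Proof.
move=> st; pose m := (t2 - t1) / (s2 - s1).
have m0 : 0 < m.
  case: st => -[s12 t12]; first by rewrite divr_gt0 ?subr_gt0.
  by rewrite /m -(opprB t1) -(opprB s1) invrN mulrNN divr_gt0 ?subr_gt0.
have s21 : s2 - s1 != 0.
  by rewrite subr_eq0; case: st => -[s12 _]; [rewrite gt_eqF|rewrite lt_eqF].
have [k [kL kR]] := kink_ex s1 m0 m0; have [e eE] := translation_ex (t1 - s1).
exists (e * k)%g; rewrite !autM !eE; split; first by rewrite kL // subrr mulr0 addr0 subrKC.
have -> : k s2 = s1 + m * (s2 - s1) by case: (leP s2 s1) => s; [rewrite kL|rewrite kR ?ltW].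
by rewrite /m mulfVK //; ring.
Qed.

(* [ord s z] is [z < s] for half-lines unbounded below and [s < z] for those
   unbounded above. *)
Lemma homogeneous_of_cuts g (ord : R -> R -> Prop) :
  (forall (c : G) s z, ord (c s) (c z) <-> ord s z) ->
  (forall f, half_line g f -> exists s, forall z, f z <> z <-> ord s z) ->
  (forall s1 s2, s1 <> s2 -> (forall z, ord s1 z -> ord s2 z) -> ord s2 s1) ->
  (forall s1 s2 t1 t2, ord s2 s1 -> ord t2 t1 ->
    (s1 < s2 /\ t1 < t2) \/ (s2 < s1 /\ t2 < t1)) -> homogeneous g.
Proof.
move=> ordc cut ord_lt ord_same f1 f2 hf1 hf2 f12 f21 k1 k2 hk1 hk2 k12 k21.
have [s1 s1P] := cut _ hf1; have [s2 s2P] := cut _ hf2.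
have [t1 t1P] := cut _ hk1; have [t2 t2P] := cut _ hk2.
have sub f k s t : half_line g f -> half_line g k -> (forall z, f z <> z <-> ord s z) ->
    (forall z, k z <> z <-> ord t z) -> supp_le f k -> ~ supp_le k f -> ord t s.
  move=> [/(is_bumpP real_flexible)[x fO] _] [/(is_bumpP real_flexible)[y kO] _] sP tP.
  move=> /(supp_leP real_flexible fO kO) fk kf; apply: ord_lt => [st|z /sP/fk/tP //].
  by apply: kf; apply: supp_le_incl => z /tP; rewrite -st => /sP.
have [c [c1 c2]] := increasing_two_points (ord_same _ _ _ _
  (sub _ _ _ _ hf1 hf2 s1P s2P f12 f21) (sub _ _ _ _ hk1 hk2 t1P t2P k12 k21)).
have E f k s t : (forall z, f z <> z <-> ord s z) -> (forall z, k z <> z <-> ord t z) ->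
    c s = t -> forall z, conjl c f z <> z <-> k z <> z.
  move=> sP tP cst z; rewrite conjl_moved sP tP -cst -{2}(autVK c z).
  by rewrite (ordc c).
have E1 := E _ _ _ _ s1P t1P c1; have E2 := E _ _ _ _ s2P t2P c2.
exists c; split; first by apply: supp_le_incl => z /E1.
split; first by apply: supp_le_incl => z /E1.
by split; apply: supp_le_incl => z /E2.
Qed.

(** A half-line ending at a point [x] moved by [h] is carried by [h] to one ending at [h x]. *)
Lemma faithful_of_cuts g (ord : R -> R -> Prop) :
  (forall (c : G) s z, ord (c s) (c z) <-> ord s z) ->
  (forall s, exists2 f, half_line g f & forall z, f z <> z <-> ord s z) ->
  (forall s t, s <> t -> exists z, ~ (ord s z <-> ord t z)) -> faithful g.
Proof.
move=> ordc cut sep h /aut_moves[x hx]; have [f hf fP] := cut x; exists f; split=> //.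
have [[/(is_bumpP real_flexible)[y fO] _] cO] := (hf, one_orbital_conj h).
rewrite (supp_leP real_flexible fO (cO _ _ fO)) (supp_leP real_flexible (cO _ _ fO) fO).
move=> [fh hf']; have [z] := sep _ _ hx; apply.
have E : conjl h f z <> z <-> ord (h x) z.
  by rewrite conjl_moved fP -{2}(autVK h z) (ordc h).
by split=> [/E/hf'/fP|/fP/fh/E].
Qed.

Lemma moved_nomax f z : f z <> z -> exists2 z', z < z' & f z' <> z'.
Proof.
move=> fz; case: (ltgtP z (f z)) => zf; last by case: fz.
  by exists (f z) => // /aut_inj.
exists ((f^-1)%g z); first by rewrite aut_ltVr.
by rewrite autVK => e; apply: fz; rewrite {1}e autVK.
Qed.

Lemma moved_nomin f z : f z <> z -> exists2 z', z' < z & f z' <> z'.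
Proof.
move=> fz; case: (ltgtP z (f z)) => zf; last by case: fz.
  exists ((f^-1)%g z); first by rewrite aut_ltV.
  by rewrite autVK => e; apply: fz; rewrite {1}e autVK.
by exists (f z) => // /aut_inj.
Qed.

Lemma real_full_bump g : (forall x, x < g x) ->
  full_bump g /\ forall x y, orb (cyc g) x y.
Proof.
move=> gup; have gO x : one_orbital g x by apply: real_one_orbital.
split=> [|x y]; last by apply: (gO x).2; apply/eqP; rewrite gt_eqF.
split; first by apply/(is_bumpP real_flexible); exists 0.
move=> h /(disjP real_flexible) hg; apply: order_aut_eq => x; apply: contrapT => /hg gx.
by have := gup x; rewrite gx ltxx.
Qed.

Lemma lower_bump_cut f : lower_bump f -> exists s, forall z, f z <> z <-> z < s.
Proof.
move=> [[x [fx _]] down [y fy]].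
have [|z fz|s [sub slub]] := @real_lub (fun z => f z <> z) y; first by exists x.
  by rewrite leNgt; apply/negP => /ltW/(down _ _ fz).
exists s => z; split=> [/moved_nomax[z' zz' /sub]|zs]; first exact: lt_le_trans.
apply: contrapT => nz; move: zs; rewrite ltNge => /negP; apply; apply: slub => t ft.
by rewrite leNgt; apply/negP => /ltW/(down _ _ ft).
Qed.

Lemma upper_bump_cut f : upper_bump f -> exists s, forall z, f z <> z <-> s < z.
Proof.
move=> [[x [fx _]] up [y fy]].
have [|z fz|s [sub slub]] := @real_lub (fun z => f z = z) x; first by exists y.
  by rewrite leNgt; apply/negP => /ltW xz; apply: (up _ _ fx xz).
exists s => z; split=> [/moved_nomin[z' zz' fz']|sz].
  apply: le_lt_trans zz'; apply: slub => t ft; rewrite leNgt; apply/negP => /ltW tz.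
  exact: up fz' tz ft.
by move=> /sub; rewrite leNgt sz.
Qed.

Lemma lower_bump_ex s : exists2 f, lower_bump f & forall z, f z <> z <-> z < s.
Proof.
have [||f [fL fR]] := @kink_ex s (1 / 2) 1; try lra.
have fup z : z < s -> z < f z by move=> zs; rewrite fL; lra.
have fE z : f z <> z <-> z < s.
  split=> [fz|/fup]; last by rewrite lt_def => /andP[/eqP].
  by rewrite ltNge; apply/negP => sz; apply: fz; rewrite fR; lra.
exists f => //; split=> [|x y /fE ys xy|].
- exists (s - 1); apply: real_one_orbital => [|y z /fE ys]; first by apply: fup; lra.
  by rewrite /between => yz; apply: fup; case/orP: yz => /andP[]; lra.
- by apply/fE; apply: le_lt_trans ys.
- by exists s; rewrite fL // subrr mulr0 addr0.
Qed.

Lemma upper_bump_ex s : exists2 f, upper_bump f & forall z, f z <> z <-> s < z.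
Proof.
have [||f [fL fR]] := @kink_ex s 1 2; try lra.
have fup z : s < z -> z < f z by move=> zs; rewrite fR; lra.
have fE z : f z <> z <-> s < z.
  split=> [fz|/fup]; last by rewrite lt_def => /andP[/eqP].
  by rewrite ltNge; apply/negP => sz; apply: fz; rewrite fL; lra.
exists f => //; split=> [|x y /fE sx xy|].
- exists (s + 1); apply: real_one_orbital => [|y z /fE ys]; first by apply: fup; lra.
  by rewrite /between => yz; apply: fup; case/orP: yz => /andP[]; lra.
- by apply/fE; apply: lt_le_trans xy.
- by exists s; rewrite fL // subrr mulr0 addr0.
Qed.

Lemma real_line_like : line_like G.
Proof.
split; first exact: (flexible_has_inverted real_flexible (ltr01 : (0 : R) < 1)).
split; first exact: flexible_locally_moving real_flexible.
have [g [g1 g2]] := expanding_map.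
have gup x : x < g x by have := g1 x; lra.
have [gfull gorb] := real_full_bump gup.
have lowP := half_line_lower real_flexible gup gorb.
have upP := half_line_upper real_flexible gup gorb.
have ltc (c : G) s z : c z < c s <-> z < s by rewrite aut_lt.
have gtc (c : G) s z : c s < c z <-> s < z by rewrite aut_lt.
exists g; split=> //; split; first exact: real_separated.
split.
  apply: (@faithful_of_cuts _ (fun s z => z < s)) => // [s|s t st].
    by have [f fL fP] := lower_bump_ex s; exists f => //; apply/lowP.
  case: (ltgtP s t) => // lt_st; [exists s|exists t] => -[H1 H2].
    by have := H2 lt_st; rewrite ltxx.
  by have := H1 lt_st; rewrite ltxx.
split.
  apply: (@homogeneous_of_cuts _ (fun s z => z < s)) => // [f /lowP/lower_bump_cut //|s t st H|].
    by case: (ltgtP s t) => // /H; rewrite ltxx.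
  by move=> s1 s2 t1 t2 ? ?; left.
split.
  apply: (@faithful_of_cuts _ (fun s z => s < z)) => // [s|s t st].
    by have [f fL fP] := upper_bump_ex s; exists f => //; apply/upP.
  case: (ltgtP s t) => // lt_st; [exists t|exists s] => -[H1 H2].
    by have := H1 lt_st; rewrite ltxx.
  by have := H2 lt_st; rewrite ltxx.
apply: (@homogeneous_of_cuts _ (fun s z => s < z)) => // [f /upP/upper_bump_cut //|s t st H|].
  by case: (ltgtP s t) => // /H; rewrite ltxx.
by move=> s1 s2 t1 t2 ? ?; right.
Qed.

End RealLine.

(** * Back-and-forth *)

Section FiniteExtension.
Variables (d1 d2 : Order.disp_t) (A : orderType d1) (B : orderType d2).
Local Open Scope order_scope.

(** Equality of the weak comparisons also makes the list functional and injective, that is, a finite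
    partial isomorphism. *)
Definition order_matching (l : seq (A * B)) :=
  {in l &, forall p q, (p.1 <= q.1) = (p.2 <= q.2)}.

Lemma seq_max (s : seq B) : s = [::] \/ exists2 m, m \in s & {in s, forall x, x <= m}.
Proof.
elim: s => [|x s [->|[m ms mP]]]; first by left.
  by right; exists x => [|y]; rewrite ?mem_head // inE => /eqP->.
right; case: (leP x m) => xm.
  by exists m => [|y]; rewrite inE ?ms ?orbT // => /orP[/eqP->|/mP].
exists x => [|y]; rewrite ?mem_head // inE => /orP[/eqP->//|/mP ym].
exact: le_trans ym (ltW xm).
Qed.

Lemma seq_min (s : seq B) : s = [::] \/ exists2 m, m \in s & {in s, forall x, m <= x}.
Proof.
elim: s => [|x s [->|[m ms mP]]]; first by left.
  by right; exists x => [|y]; rewrite ?mem_head // inE => /eqP->.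
right; case: (leP m x) => xm.
  by exists m => [|y]; rewrite inE ?ms ?orbT // => /orP[/eqP->|/mP].
exists x => [|y]; rewrite ?mem_head // inE => /orP[/eqP->//|/mP ym].
exact: le_trans (ltW xm) ym.
Qed.

Hypothesis endB : no_endpoints B.
Hypothesis denseB : forall x y : B, x < y -> exists2 z, x < z & z < y.

Lemma finite_gap (b0 : B) (s t : seq B) : {in s & t, forall x y, x < y} ->
  exists b, {in s, forall x, x < b} /\ {in t, forall y, b < y}.
Proof.
move=> st; case: (seq_max s) => [->|[m ms mP]]; case: (seq_min t) => [->|[n nt nP]].
- by exists b0.
- have [[b bn] _] := endB n; exists b; split=> // y /nP; exact: lt_le_trans.
- have [_ [b mb]] := endB m; exists b; split=> // x /mP xm; exact: le_lt_trans mb.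
- have [b mb bn] := denseB (st _ _ ms nt); exists b; split=> [x /mP xm|y /nP].
    exact: le_lt_trans mb.
  exact: lt_le_trans.
Qed.

Lemma matching_extend (b0 : B) l a : order_matching l ->
  exists b, order_matching ((a, b) :: l).
Proof.
move=> lM; suff [b bP] : exists b,
    {in l, forall p, (p.1 <= a) = (p.2 <= b) /\ (a <= p.1) = (b <= p.2)}.
  exists b => p q; rewrite !inE => /orP[/eqP->|pl] /orP[/eqP->|ql] /=; last exact: lM.
  - by rewrite !lexx.
  - by case: (bP _ ql).
  - by case: (bP _ pl).
have [[b ab]|nb] := pselect (exists b, (a, b) \in l).
  by exists b => p pl; split; [exact: (lM p (a, b))|exact: (lM (a, b) p)].
pose s := [seq p.2 | p <- l & p.1 < a]; pose t := [seq p.2 | p <- l & a < p.1].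
have [|b [sb tb]] := finite_gap b0 (s := s) (t := t).
  move=> _ _ /mapP[p + ->] /mapP[q + ->]; rewrite !mem_filter => /andP[pa pl] /andP[aq ql].
  by rewrite ltNge -lM // -ltNge (lt_trans pa aq).
exists b => -[x y] pl /=; case: (ltgtP x a) => xa.
- have yb : y < b by apply: sb; apply/mapP; exists (x, y); rewrite ?mem_filter ?xa.
  by rewrite (ltW yb) leNgt yb.
- have yb : b < y by apply: tb; apply/mapP; exists (x, y); rewrite ?mem_filter ?xa.
  by rewrite (ltW yb) leNgt yb.
- by case: nb; exists y; rewrite -xa.
Qed.

End FiniteExtension.

Section CutExtension.
Variables (d1 d2 : Order.disp_t) (A : orderType d1) (B : orderType d2).
Local Open Scope order_scope.
Variable M : A -> B -> Prop.
Hypothesis matchM : forall t r t' r', M t r -> M t' r' -> (t < t') = (r < r').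
Hypothesis endA : no_endpoints A.
Hypothesis endB : no_endpoints B.
Hypothesis denseA : forall x y : A, x < y -> exists t r, [/\ x < t, t < y & M t r].
Hypothesis denseB : forall x y : B, x < y -> exists2 z, x < z & z < y.
Hypothesis completeB : cut_complete B.

(** [b] is the supremum of the partners of matched points below [z]. Strictness comes from inserting
    one more matched point between [t] and [z]. *)
Lemma cut_value z : exists b, forall t r, M t r -> (t < z -> r < b) /\ (z < t -> b < r).
Proof.
have [[x xz] [y zy]] := endA z.
have [t0 [r0 [_ t0z Mt0]]] := denseA xz; have [t1 [r1 [zt1 _ Mt1]]] := denseA zy.
have [||||b bP] := completeB (L := fun y => exists t r, [/\ M t r, t < z & y < r]).
- by move=> u v [t [r [Mt tz vr]]] uv; exists t, r; split=> //; apply: le_lt_trans vr.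
- by have [[u ur] _] := endB r0; exists u, t0, r0.
- exists r1 => -[t [r [Mt tz]]]; rewrite -(matchM Mt1 Mt) => /(lt_trans zt1).
  by move=> /(lt_trans tz); rewrite ltxx.
- move=> u [t [r [Mt tz ur]]]; have [v uv vr] := denseB ur.
  by exists v => //; exists t, r.
exists b => t r Mt; split=> [tz|zt].
  have [t' [r' [tt' t'z Mt']]] := denseA tz.
  by apply/bP; exists t', r'; rewrite -(matchM Mt Mt').
have [t' [r' [zt' t't Mt']]] := denseA zt.
apply: (@le_lt_trans _ _ r'); last by rewrite -(matchM Mt' Mt).
rewrite leNgt; apply/negP => /bP[t2 [r2 [Mt2 t2z]]]; rewrite -(matchM Mt' Mt2).
by move=> /(lt_trans zt')/(lt_trans t2z); rewrite ltxx.
Qed.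

End CutExtension.

Section Cantor.
Variables (d1 d2 : Order.disp_t) (A : orderType d1) (B : orderType d2).
Local Open Scope order_scope.

Lemma dense_seq_between (d : Order.disp_t) (T : orderType d) (D : nat -> T) :
  dense_seq D -> forall x y : T, x < y -> exists2 z, x < z & z < y.
Proof. by move=> dD x y /dD[n [? ?]]; exists (D n). Qed.

Lemma matching_swap (l : seq (A * B)) : order_matching l ->
  order_matching [seq (p.2, p.1) | p <- l].
Proof. by move=> lM _ _ /mapP[p pl ->] /mapP[q ql ->] /=; rewrite lM. Qed.

Lemma back_and_forth (D : nat -> A) (E : nat -> B) :
  no_endpoints A -> no_endpoints B -> dense_seq D -> dense_seq E ->
  exists M : A -> B -> Prop, [/\ forall t r t' r', M t r -> M t' r' -> (t < t') = (r < r'),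
    forall n, exists r, M (D n) r & forall n, exists t, M t (E n)].
Proof.
move=> endA endB dD dE.
have step l n : exists l' : seq (A * B), order_matching l ->
    [/\ order_matching l', {subset l <= l'}, exists r, (D n, r) \in l' & exists t, (t, E n) \in l'].
  (* The empty list is a dummy value that makes the step total, so that it can be iterated as a
     function. *)
  have [lM|] := pselect (order_matching l); last by exists [::].
  have [r rM] := matching_extend endB (dense_seq_between dE) (E 0) (D n) lM.
  have [t tM] := matching_extend endA (dense_seq_between dD) (D 0) (E n) (matching_swap rM).
  exists [:: (t, E n), (D n, r) & l] => _; split.
  - move=> p q pl ql; apply/esym; pose swap (p : A * B) := (p.2, p.1).
    exact: (tM (swap p) (swap q) (map_f swap pl) (map_f swap ql)).
  - by move=> p pl; rewrite !inE pl !orbT.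
  - by exists r; rewrite !inE eqxx orbT.
  - by exists t; rewrite mem_head.
have /choice[F FP] : forall ln : seq (A * B) * nat, exists l', _ := fun ln => step ln.1 ln.2.
pose st := fix st n := if n is m.+1 then F (st m, m) else [::].
have stM n : order_matching (st n).
  by elim: n => [//|n IH] /=; case: (FP (st n, n) IH).
have sub m n : (m <= n)%N -> {subset st m <= st n}.
  move=> mn; rewrite -(subnK mn); elim: (n - m)%N => // k IH p /IH.
  by rewrite addSn /=; case: (FP (st (k + m)%N, (k + m)%N) (stM _)) => _ + _ _; apply.
exists (fun t r => exists n, (t, r) \in st n); split=> [t r t' r' [m tr] [n tr']|n|n].
- have := sub _ _ (leq_maxl m n) _ tr; have := sub _ _ (leq_maxr m n) _ tr'.
  by move=> H' H; rewrite !ltNge (stM _ _ _ H' H).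
- have [_ _ [r rn] _] := FP (st n, n) (stM n); by exists r, n.+1.
- have [_ _ _ [t tn]] := FP (st n, n) (stM n); by exists t, n.+1.
Qed.

Lemma cantor_isomorphism (D : nat -> A) (E : nat -> B) :
  no_endpoints A -> no_endpoints B -> dense_seq D -> dense_seq E ->
  cut_complete A -> cut_complete B -> order_isomorphic A B.
Proof.
move=> endA endB dD dE cA cB.
have [M [MM MD ME]] := back_and_forth endA endB dD dE.
have denA x y : x < y -> exists t r, [/\ x < t, t < y & M t r].
  by move=> /dD[n [xn ny]]; have [r Mr] := MD n; exists (D n), r.
have denB x y : x < y -> exists r t, [/\ x < r, r < y & M t r].
  by move=> /dE[n [xn ny]]; have [t Mt] := ME n; exists (E n), t.
have /choice[f fP] := cut_value MM endA endB denA (dense_seq_between dE) cB.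
have /choice[g gP] := cut_value (M := fun r t => M t r)
  (fun _ _ _ _ H H' => esym (MM _ _ _ _ H H'))
  endB endA denB (dense_seq_between dD) cA.
have f_lt x y : x < y -> f x < f y.
  move=> /denA[t [r [xt ty Mt]]]; have [_ /(_ xt) xr] := fP x _ _ Mt.
  by have [/(_ ty) ry _] := fP y _ _ Mt; apply: lt_trans ry.
have f_mono : {mono f : x y / x <= y} by apply: le_mono.
(* Any matched pair whose second component lies strictly between [f (g y)] and [y] would be put on
   opposite sides by the two cut conditions. *)
have fg y : f (g y) = y.
  case: (ltgtP (f (g y)) y) => // /denB[r [t [lr rh Mt]]].
    have [/(_ rh) tg _] := gP y _ _ Mt; have [/(_ tg) rf _] := fP (g y) _ _ Mt.
    by have := lt_trans lr rf; rewrite ltxx.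
  have [_ /(_ lr) tg] := gP y _ _ Mt; have [_ /(_ tg) rf] := fP (g y) _ _ Mt.
  by have := lt_trans rh rf; rewrite ltxx.
exists f; split=> //; exists g => // x.
by apply: (inc_inj f_mono); rewrite fg.
Qed.

End Cantor.

Section Recognition.
Variable R : realType.
Local Open Scope ring_scope.

Lemma real_no_endpoints : no_endpoints R.
Proof. by move=> x; split; [exists (x - 1)|exists (x + 1)]; lra. Qed.

Lemma real_dense_seq : exists D : nat -> R, dense_seq D.
Proof.
exists (fun n => if unpickle n is Some q then ratr q else 0) => x y xy.
have [q] := rat_in_itvoo xy; rewrite in_itv /= => /andP[xq qy].
by exists (pickle q); rewrite pickleK.
Qed.

Lemma real_cut_complete : cut_complete R.
Proof.
move=> L Ldown L0 [b0 Lb] Lmax; have [x Lx|s [sub slub]] := @real_lub R L b0 L0.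
  by rewrite leNgt; apply/negP => /ltW/(Ldown _ _ Lx).
exists s => x; split=> [/Lmax[y /sub ys xy]|xs]; first exact: lt_le_trans ys.
apply: contrapT => nx; move: xs; rewrite ltNge => /negP; apply; apply: slub => y Ly.
by rewrite leNgt; apply/negP => /ltW/(Ldown _ _ Ly).
Qed.

End Recognition.

Lemma separatedV (G : groupType) (g : G) : separated g -> separated g^-1.
Proof.
move=> [h [w [hw [ind rig]]]]; exists h, w; split=> //; split=> // u ug; apply: rig.
by have := commuteV ug; rewrite invgK.
Qed.

Theorem theorem1 (R : realType) (d : Order.disp_t) (Omega : orderType d)
    (htrans : aut_transitive Omega)
    (hequiv : elementarily_equivalent (order_aut Omega) (order_aut R)) :
  order_isomorphic Omega R.
Proof.
have [inv [loc [g [gfull [gsep [gf [gh [gVf gVh]]]]]]]] :=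
  line_like_equiv hequiv (real_line_like R).
have flex := transitive_flexible loc inv htrans.
have noend := transitive_no_endpoints htrans inv.
have gmv := full_bump_moves flex noend gfull.
have [x0 _] : exists x, g x <> x by have [_ [f [/aut_moves[x _] _]]] := inv; exists x.
(* A full bump moves all points in one direction; pass to its inverse if that direction is down. *)
have [f [fup forb fsep [ffaith fhom]]] : exists f : order_aut Omega, [/\ forall x, (x < f x)%O,
    forall x y, orb (cyc f) x y, separated f & faithful f /\ homogeneous f].
  have gorb x y := full_bump_orb flex noend x y gfull.
  case: (ltgtP x0 (g x0)) => gx; last by case: (gmv x0).
    by exists g; split=> // x; exact: (orb_cyc_up gx (gorb x0 x)).
  exists g^-1%g; split=> //; last exact: separatedV.
    by move=> x; rewrite aut_ltVr; exact: (orb_cyc_down gx (gorb x0 x)).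
  by move=> x y; apply/orb_cycV.
have [D dD] := separated_dense_seq flex fup fsep x0.
have [E dE] := real_dense_seq R.
apply: (cantor_isomorphism noend (@real_no_endpoints R) dD dE).
  exact: (homogeneous_complete flex noend fup forb ffaith fhom dD).
exact: real_cut_complete.
Qed.
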